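(* Let $c\ge 0$ and $M>0$ be fixed constants. For each $n\ge 2$ let $\mathcal{F}$ be the hypothesis space of the variational $n$-qubit circuit $F=(B_nB_{n-1}\cdots B_2)^{\lceil M n^c\rceil}$. Then $\mathcal{F}$ is PAC learnable (with respect to the trace-distance loss) with sample complexity $$\nu(\epsilon,\delta)=O\!\left(\frac{1}{\epsilon^2}\Big(n^{c+1}\ln\frac{n}{\epsilon}+\ln\frac{1}{\delta}\Big)\right),$$ where the implied constant is independent of $n,\epsilon,\delta$ (it may depend on $c$ and $M$).
   Context: $\mathcal{X}=\mathcal{Y}$ is the set of all $n$-qubit pure states, i.e. unit vectors in $(\mathbb{C}^2)^{\otimes n}$ up to global phase; for $x\in\mathcal{X}$ write $|\psi(x)\rangle$ for a representing unit vector. Variational circuit: $H$ is the Hadamard gate, $X$ the Pauli $X$ matrix, $R_x(\theta)=e^{-i\theta X/2}$, and $\mathrm{CNOT}_{1i}$ is the controlled-NOT with control qubit $1$ and target qubit $i$. A level-1 block is a single-qubit gate $L=HR_x(\beta)HR_x(\gamma)HR_x(\delta)H$ with free parameters $\beta,\gamma,\delta\in[0,2\pi)$. For $i=2,\dots,n$, a level-2 block is $$B_i=\mathrm{CNOT}_{1i}\,(L^{(3)}_1\otimes L^{(4)}_i)\,\mathrm{CNOT}_{1i}\,(L^{(1)}_1\otimes L^{(2)}_i),$$ where $L^{(k)}_j$ denotes a level-1 block acting on qubit $j$, and the four level-1 blocks have independent parameters. A layer is $B_nB_{n-1}\cdots B_2$, and a power $(B_n\cdots B_2)^d$ denotes a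 product of $d$ layers in which every block occurrence has its own independent parameters. The hypothesis space $\mathcal{F}$ is the set of all functions $f_h:\mathcal{X}\to\mathcal{Y}$ of the form $|\psi(f_h(x))\rangle=F(\boldsymbol\theta)|\psi(x)\rangle$, where $\boldsymbol\theta$ ranges over all assignments of values in $[0,2\pi)$ to the parameters of $F$. Loss: $\mathcal{L}(y_1,y_2)=\frac12\big\||\psi(y_1)\rangle\langle\psi(y_1)|-|\psi(y_2)\rangle\langle\psi(y_2)|\big\|_1\in[0,1]$, with $\|\cdot\|_1$ the trace norm. For a probability measure $P$ on $\mathcal{X}\times\mathcal{Y}$ and a training set $S=(x_i,y_i)_{i=1}^m$ sampled i.i.d. from $P$, the risk and empirical risk of $f$ are $R(f)=\int\mathcal{L}(y,f(x))\,dP(x,y)$ and $\hat R(f)=\frac1m\sum_{i=1}^m\mathcal{L}(y_i,f(x_i))$. Let $\hat h=\arg\min_{h'\in\mathcal{F}}\hat R(h')$ (empirical risk minimizer) and $h=\arg\min_{h'\in\mathcal{F}}R(h')$ (risk minimizer). PAC learnability: a hypothesis space $\mathcal{F}$ is PAC learnable with sample complexity $\nu:(0,1)^2\to\mathbb{N}$ if for all $(\epsilon,\delta)\in(0,1)^2$ and all probability measures $P$ on $\mathcal{X}\times\mathcal{Y}$, whenever $|S|\ge\nu(\epsilon,\delta)$ one has $\mathbb{P}_S\big(R(\hat h)-R(h)\le\epsilon\big)\ge 1-\delta$, where $\mathbb{P}_S$ is the probability over the sampling of $S$. *)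

(* Defs.v *)
From HB Require Import structures.
From mathcomp Require Import all_boot all_order all_algebra spectral generic_quotient.
From mathcomp Require Import complex.
From mathcomp Require Import all_classical all_reals all_analysis.

Set Implicit Arguments.
Unset Strict Implicit.
Unset Printing Implicit Defensive.

Import Order.TTheory GRing.Theory Num.Theory.
Import numFieldNormedType.Exports.

Local Open Scope classical_set_scope.
Local Open Scope ring_scope.
Local Open Scope sesquilinear_scope.
Local Open Scope quotient_scope.

(* [complex R] has no topology of its own; viewed as a [numClosedFieldType] it
   inherits the one attached to every [numFieldType]. *)
Definition Cplx (R : realType) : numClosedFieldType := complex R.

Definition qdim (n : nat) : nat := #|{: n.-tuple 'I_2}|.

Section gates.
Context {R : realType}.
Local Notation C := (Cplx R).

(* e^A is the sum of the exponential series in the entrywise topology. *)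
Definition expmx k (A : 'M[C]_k) : 'M[C]_k :=
  limn (series (fun j => (j`!)%:R^-1 *: A ^+ j)).

Definition hadamard : 'M[C]_2 :=
  \matrix_(i < 2, j < 2) ((-1) ^+ (i * j) / sqrtC 2).

Definition pauliX : 'M[C]_2 := \matrix_(i < 2, j < 2) (i != j)%:R.

Definition rx (t : R) : 'M[C]_2 := expmx ((- 'i * (t%:C%C : C) / 2) *: pauliX).

Definition gate1 (t : 'I_3 -> R) : 'M[C]_2 :=
  hadamard *m rx (t 0) *m hadamard *m rx (t 1) *m hadamard *m rx (t 2)
  *m hadamard.

Definition bit n (a : 'I_(qdim n)) (q : nat) : 'I_2 := nth 0 (enum_val a) q.

(* 1 (x) ... (x) U (x) ... (x) 1 with U on qubit q; qubits are numbered from 0,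
   so that qubit j of the usual numbering is qubit j - 1 here. *)
Definition on_qubit n (q : nat) (U : 'M[C]_2) : 'M[C]_(qdim n) :=
  \matrix_(a < qdim n, b < qdim n)
    (U (bit a q) (bit b q)
     * [forall k : 'I_n, (k != q :> nat) ==> (bit a k == bit b k)]%:R).

(* |0><0| (x) 1 + |1><1| (x) X *)
Definition cnot n (i : nat) : 'M[C]_(qdim n) :=
  on_qubit n 0 (delta_mx 0 0) + on_qubit n 0 (delta_mx 1 1) *m on_qubit n i pauliX.

Definition block n (i : nat) (t : 'I_4 -> 'I_3 -> R) : 'M[C]_(qdim n) :=
  cnot n i *m (on_qubit n 0 (gate1 (t 2)) *m on_qubit n i (gate1 (t 3)))
  *m cnot n i *m (on_qubit n 0 (gate1 (t 0)) *m on_qubit n i (gate1 (t 1))).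

(* The rightmost factor is the block with target qubit 1. *)
Definition layer n (t : nat -> 'I_4 -> 'I_3 -> R) : 'M[C]_(qdim n) :=
  \prod_(i <- rev (iota 1 n.-1)) block n i (t i).

(* t l i k p is the p-th parameter of the k-th level-1 gate of the block with
   target qubit i in layer l; values at l >= d or i outside [1, n) are unused. *)
Definition circuit n (d : nat) (t : nat -> nat -> 'I_4 -> 'I_3 -> R) :
    'M[C]_(qdim n) :=
  \prod_(l < d) layer n (t l).

End gates.

Section pure_states.
Context {R : realType}.
Local Notation C := (Cplx R).

Definition unit_vectors n : set 'cV[C]_(qdim n) :=
  [set v | \sum_i `|v i 0| ^+ 2 = 1].
Arguments unit_vectors n : clear implicits.

Lemma unit_vectors_delta n :
  unit_vectors n (delta_mx (enum_rank [tuple of nseq n (0 : 'I_2)]) 0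
                : 'cV[C]_(qdim n)).
Proof.
rewrite /unit_vectors/= (bigD1 (enum_rank [tuple of nseq n 0]))//= big1.
  by rewrite mxE !eqxx normr1 expr1n addr0.
by move=> i /negbTE ni; rewrite mxE ni normr0 expr0n.
Qed.

HB.instance Definition _ n := isPointed.Build (unit_vectors n)
  (SigSub (mem_set (unit_vectors_delta n)) : unit_vectors n).

Definition phase_equiv n (u v : 'cV[C]_(qdim n)) : Prop :=
  exists2 z : C, `|z| = 1 & u = z *: v.

Definition phase_rel n : rel (unit_vectors n) :=
  fun u v => `[< phase_equiv (val u) (val v) >].

Lemma phase_rel_equiv n : equiv_class_of (@phase_rel n).
Proof.
split.
- by move=> u; apply/asboolP; exists 1; rewrite ?normr1 ?scale1r.
- suff H u v : @phase_rel n u v -> phase_rel v u.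
    by move=> u v; apply/idP/idP; exact: H.
  move=> /asboolP[z z1 e]; apply/asboolP; exists z^-1.
    by rewrite normfV z1 invr1.
  by rewrite e scalerA mulVf ?scale1r// -normr_gt0 z1 ltr01.
- move=> v u w /asboolP[z z1 e] /asboolP[y y1 e']; apply/asboolP.
  by exists (z * y); [rewrite normrM z1 y1 mulr1|rewrite e e' scalerA].
Qed.

Canonical phase_equiv_rel n := EquivRelPack (@phase_rel_equiv n).

Definition state_space n := quotient_topology {eq_quot (phase_equiv_rel n)}.

(* [g_sigma_algebraType open] carries the Borel sigma-algebra of the quotient
   topology of the unit sphere modulo phases. *)
Definition pure_state n := g_sigma_algebraType (@open (state_space n)).

Definition psi n (x : pure_state n) : 'cV[C]_(qdim n) :=
  \val (repr (x : state_space n)).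

(* The eigenvalues of A^t* A are nonnegative and their square roots are the
   singular values of A. *)
Definition trace_norm k (A : 'M[C]_k) : R :=
  complex.Re (\sum_i sqrtC (spectral_diag (A^t* *m A) 0 i) : C).

Definition trace_dist n (x y : pure_state n) : R :=
  2^-1 * trace_norm (psi x *m (psi x)^t* - psi y *m (psi y)^t*).

(* States are defined up to a global phase, hence so is the defining equation
   psi (f x) = F(t) psi x. *)
Definition hypotheses n d : set (pure_state n -> pure_state n) :=
  [set f | exists2 t : nat -> nat -> 'I_4 -> 'I_3 -> R,
    (forall l i k p, 0 <= t l i k p < 2 * pi) &
    forall x, phase_equiv (psi (f x)) (circuit n d t *m psi x)].

End pure_states.
Arguments pure_state R n : clear implicits.
Arguments hypotheses R n d : clear implicits.
Arguments trace_dist R n : clear implicits.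

Section learning.
Context {R : realType}.

Section product_measure.
Context {d : measure_display} {T : measurableType d}.

Definition sample_cons m (zs : T * m.-tuple T) : m.+1.-tuple T :=
  [the m.+1.-tuple T of zs.1 :: zs.2].

Lemma measurable_sample_cons m : measurable_fun setT (@sample_cons m).
Proof. exact: measurable_cons. Qed.

HB.instance Definition _ m := isMeasurableFun.Build _ _ _ _ (@sample_cons m)
  (@measurable_sample_cons m).

(* The product measure P^m on m-tuples, built one factor at a time. *)
Fixpoint iid (P : probability T R) m : probability (m.-tuple T) R :=
  if m is m'.+1 then distribution (P \x iid P m')%E (@sample_cons m')
  else \d_([tuple] : 0.-tuple T).

(* The random set A need not be measurable, so "A has probability at least p"
   is read as: A contains an event of probability at least p. *)
Definition prob_ge (P : probability T R) (A : set T) (p : R) : Prop :=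
  exists B, [/\ measurable B, B `<=` A & (p%:E <= P B)%E].

End product_measure.

Section pac.
Context {dX dY : measure_display} {X : measurableType dX} {Y : measurableType dY}.
Variable loss : Y -> Y -> R.

Definition risk (P : probability (X * Y)%type R) (f : X -> Y) : R :=
  (\int[P]_z loss z.2 (f z.1))%R.

Definition empirical_risk m (S : m.-tuple (X * Y)) (f : X -> Y) : R :=
  m%:R^-1 * \sum_(i < m) loss (tnth S i).2 (f (tnth S i).1).

Definition argmin (F : set (X -> Y)) (r : (X -> Y) -> R) : set (X -> Y) :=
  [set f | F f /\ forall g, F g -> r f <= r g].

(* Minimizers need not be unique; every choice of hhat is required to work. *)
Definition pac_learnable (F : set (X -> Y)) (nu : R -> R -> nat) : Prop :=
  forall eps delta : R, 0 < eps < 1 -> 0 < delta < 1 ->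
  forall (P : probability (X * Y)%type R) (h : X -> Y), argmin F (risk P) h ->
  forall m, (nu eps delta <= m)%N ->
  prob_ge (iid P m)
    [set S | forall hhat, argmin F (empirical_risk S) hhat ->
                          risk P hhat - risk P h <= eps]
    (1 - delta).

End pac.
End learning.

(* Main.v *)
From HB Require Import structures.
Require Import Defs.
From mathcomp Require Import all_boot all_order all_algebra spectral.
From mathcomp Require Import generic_quotient complex ring lra.
From mathcomp Require Import all_classical all_reals all_analysis.
From mathcomp Require Import measurable_realfun.
Import Order.TTheory GRing.Theory Num.Theory.
Import numFieldNormedType.Exports.

Set Implicit Arguments.
Unset Strict Implicit.
Unset Printing Implicit Defensive.

Local Open Scope classical_set_scope.
Local Open Scope ring_scope.

(* The hypotheses are covered by a finite grid of parameters, and a Chernoff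
   bound is applied to each grid point. For pure states u, v the trace distance
   is sqrt (1 - |<u, v>|^2). All gates are unitary and x |-> rx x is
   1-Lipschitz in operator norm, so the circuit is Lipschitz in the sup norm of
   its p = 12 (n - 1) d parameters with constant p. Since
   |sqrt a - sqrt b| <= sqrt |a - b|, the loss moves by at most sqrt (2 p s)
   when the parameters move by s: a grid with O(p / eps^2) points per parameter
   suffices, and the square root only costs a constant factor in the logarithm
   of its cardinality, which is O(p ln (p / eps)). *)

(** * Pure states and isometries over a closed field *)

(** Two measurability obstacles shape the proof. [psi] picks an arbitrary representative of a phase
    class, so nothing is claimed about its own measurability: everything goes through the projector
    onto [psi x], which ignores the phase and is continuous on the quotient. The empirical minimizer
    is an arbitrary choice depending on the sample, so its deviation is never treated as an event:
    the exceptional event involves only the grid losses and the fixed risk minimizer [h], and is a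
    finite union of measurable sets. Grid points enter as matrices, through [overlap_loss], and are
    never turned into maps between states. *)

Section hermitian_space.
Local Open Scope sesquilinear_scope.
Variable C : numClosedFieldType.

Lemma adjmx_mul m n p (A : 'M[C]_(m, n)) (B : 'M[C]_(n, p)) :
  (A *m B)^t* = B^t* *m A^t*.
Proof. by rewrite trmx_mul map_mxM. Qed.

Lemma adjmxD m n (A B : 'M[C]_(m, n)) : (A + B)^t* = A^t* + B^t*.
Proof. by rewrite linearD/= map_mxD. Qed.

Lemma adjmxN m n (A : 'M[C]_(m, n)) : (- A)^t* = - A^t*.
Proof. by rewrite linearN/= map_mxN. Qed.

Lemma adjmxZ m n a (A : 'M[C]_(m, n)) : (a *: A)^t* = a^* *: A^t*.
Proof. by rewrite linearZ/= map_mxZ. Qed.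

Lemma adjmx1 n : (1%:M : 'M[C]_n)^t* = 1%:M.
Proof. by rewrite trmx1 map_mx1. Qed.

Lemma adjmxK m n (A : 'M[C]_(m, n)) : A^t*^t* = A.
Proof. by rewrite trmxCK. Qed.

Definition inner k (u v : 'cV[C]_k) : C := (u^t* *m v) 0 0.
Definition vnorm k (u : 'cV[C]_k) : C := sqrtC (inner u u).

Lemma inner_dotmx k (u v : 'cV[C]_k) : inner u v = dotmx v^T u^T.
Proof.
rewrite dotmxE /inner !mxE; apply: eq_bigr => i _.
by rewrite !mxE mulrC.
Qed.

Lemma innerE k (u v : 'cV[C]_k) : inner u v = \sum_i (u i 0)^* * v i 0.
Proof. by rewrite /inner mxE; apply: eq_bigr => i _; rewrite !mxE. Qed.

Lemma inner_normE k (u : 'cV[C]_k) : inner u u = \sum_i `|u i 0| ^+ 2.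
Proof. by rewrite innerE; apply: eq_bigr => i _; rewrite normCK mulrC. Qed.

Lemma inner_scalar k (u v : 'cV[C]_k) : u^t* *m v = (inner u v)%:M.
Proof. by rewrite [LHS]mx11_scalar. Qed.

Lemma inner_ge0 k (u : 'cV[C]_k) : 0 <= inner u u.
Proof. by rewrite inner_normE sumr_ge0// => i _; rewrite exprn_ge0. Qed.

Lemma inner_conj k (u v : 'cV[C]_k) : (inner u v)^* = inner v u.
Proof.
rewrite !innerE rmorph_sum; apply: eq_bigr => i _.
by rewrite rmorphM/= conjCK mulrC.
Qed.

Lemma innerBr k (u v w : 'cV[C]_k) : inner u (v - w) = inner u v - inner u w.
Proof. by rewrite /inner mulmxBr !mxE. Qed.

Lemma innerZr k a (u v : 'cV[C]_k) : inner u (a *: v) = a * inner u v.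
Proof. by rewrite /inner -scalemxAr mxE. Qed.

Lemma vnorm_ge0 k (u : 'cV[C]_k) : 0 <= vnorm u.
Proof. by rewrite sqrtC_ge0 inner_ge0. Qed.

Lemma vnormD k (u v : 'cV[C]_k) : vnorm (u + v) <= vnorm u + vnorm v.
Proof.
rewrite /vnorm !inner_dotmx linearD/=.
by have [] := triangle_lerif (@dotmx C k) u^T v^T.
Qed.

Lemma inner_vnorm k (u v : 'cV[C]_k) : `|inner u v| <= vnorm u * vnorm v.
Proof.
rewrite /vnorm !inner_dotmx mulrC.
by have [] := CauchySchwarz_sqrt (@dotmx C k) v^T u^T.
Qed.

Lemma vnorm_mul_scalar k (A : 'M[C]_k) c v :
  A^t* *m A = c%:M -> 0 <= c -> vnorm (A *m v) = sqrtC c * vnorm v.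
Proof.
move=> AA c0; rewrite /vnorm /inner adjmx_mul -mulmxA (mulmxA _ A) AA.
by rewrite mul_scalar_mx -scalemxAr mxE sqrtCM// nnegrE inner_ge0.
Qed.

Definition isometry_mx k (A : 'M[C]_k) := A^t* *m A = 1%:M.

Lemma isometry_mx1 k : isometry_mx (1%:M : 'M[C]_k).
Proof. by rewrite /isometry_mx adjmx1 mulmx1. Qed.

Lemma isometry_mxM k (A B : 'M[C]_k) :
  isometry_mx A -> isometry_mx B -> isometry_mx (A *m B).
Proof.
by move=> AA BB; rewrite /isometry_mx adjmx_mul -mulmxA (mulmxA _ A) AA mul1mx.
Qed.

Lemma vnorm_isometry k (A : 'M[C]_k) v :
  isometry_mx A -> vnorm (A *m v) = vnorm v.
Proof. by move=> /vnorm_mul_scalar ->//; rewrite sqrtC1 mul1r. Qed.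

(** Says that [A - B] has operator norm at most [e]; the bound lives in [C] because [vnorm] does. *)
Definition close_mx k (e : C) (A B : 'M[C]_k) :=
  forall v : 'cV[C]_k, vnorm (A *m v - B *m v) <= e * vnorm v.

Lemma close_mx0 k (A : 'M[C]_k) : close_mx 0 A A.
Proof. by move=> v; rewrite subrr mul0r /vnorm /inner mulmx0 mxE sqrtC0. Qed.

(** Telescoping: [A A' - B B' = A (A' - B') + (A - B) B']. The isometry [A] preserves the norm of
    the first term, and [B'] that of the vector fed to [A - B], so errors add along a product. *)
Lemma close_mxM k e e' (A B A' B' : 'M[C]_k) :
  isometry_mx A -> isometry_mx B' -> close_mx e A B -> close_mx e' A' B' ->
  close_mx (e + e') (A *m A') (B *m B').
Proof.
move=> AA BB AB AB' v.
have -> : A *m A' *m v - B *m B' *m v =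
    A *m (A' *m v - B' *m v) + (A *m (B' *m v) - B *m (B' *m v)).
  by rewrite mulmxBr !mulmxA addrA subrK.
rewrite (le_trans (vnormD _ _))// vnorm_isometry// addrC mulrDl lerD//.
by rewrite (le_trans (AB _))// vnorm_isometry.
Qed.

(** [B *m B = s *: B] forces every eigenvalue to be [0] or [s]. For such [x] one has
    [sqrtC x * sqrtC s = x], so multiplying the sum by [sqrtC s] turns it into the trace and no
    multiplicity has to be counted. *)
Lemma sum_sqrt_spectral_diag k (B : 'M[C]_k) s :
  B \is normalmx -> 0 <= s -> B *m B = s *: B -> \tr B = s *+ 2 ->
  \sum_i sqrtC (spectral_diag B 0 i) = sqrtC s *+ 2.
Proof.
move=> /orthomx_spectralP; set P := spectralmx B; set D := spectral_diag B.
have uP : P \in unitmx by exact: spectral_unit.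
move=> BE s0 BB trB.
have DE : diag_mx D = P *m B *m invmx P.
  by rewrite {1}BE !mulmxA mulmxV// mul1mx -mulmxA mulmxV// mulmx1.
have D2 i : D 0 i ^+ 2 = s * D 0 i.
  have : diag_mx D *m diag_mx D = s *: diag_mx D.
    rewrite DE !mulmxA mulmxKV// -(mulmxA P B B) BB.
    by rewrite -scalemxAr -scalemxAl.
  by move=> /matrixP/(_ i i); rewrite mul_diag_mx !mxE eqxx !mulr1n -expr2.
have trD : \sum_i D 0 i = s *+ 2.
  by rewrite -trB -mxtrace_diag DE mxtrace_mulC mulmxA mulVmx// mul1mx.
(* [sqrtC s] cannot be cancelled when [s = 0], but then all eigenvalues have square zero. *)
have [s_eq0|s_neq0] := eqVneq s 0.
  rewrite s_eq0 sqrtC0 mul0rn big1// => i _.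
  have /eqP := D2 i; rewrite s_eq0 mul0r sqrf_eq0 => /eqP ->.
  by rewrite sqrtC0.
apply: (@mulIf _ (sqrtC s)); first by rewrite sqrtC_eq0.
rewrite mulrnAl -expr2 sqrtCK -trD big_distrl/=; apply: eq_bigr => i _.
have /eqP := D2 i; rewrite expr2 -subr_eq0 -mulrBl mulf_eq0 subr_eq0.
case/orP => /eqP ->; first by rewrite -expr2 sqrtCK.
by rewrite sqrtC0 mul0r.
Qed.

Lemma inner1_subr_ge0 k (u v : 'cV[C]_k) : inner u u = 1 -> inner v v = 1 ->
  0 <= 1 - `|inner u v| ^+ 2.
Proof.
move=> u1 v1; rewrite subr_ge0 exprn_ile1//.
by rewrite (le_trans (inner_vnorm _ _))// /vnorm u1 v1 sqrtC1 mulr1.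
Qed.

Lemma mxtrace_projectors k (u v : 'cV[C]_k) :
  \tr (u *m u^t* *m (v *m v^t*)) = `|inner u v| ^+ 2.
Proof.
rewrite -!mulmxA mxtrace_mulC -!mulmxA (inner_scalar v u) mulmxA.
by rewrite inner_scalar -scalar_mxM mxtrace_scalar mulr1n normCK inner_conj.
Qed.

(* [A = u u^* - v v^*] has trace zero and rank at most two, hence [A^3 = s A]
   where [s] is minus its second invariant. *)
Lemma sum_sqrt_spectral_diag_pure k (u v : 'cV[C]_k) :
  inner u u = 1 -> inner v v = 1 ->
  let A := u *m u^t* - v *m v^t* in
  \sum_i sqrtC (spectral_diag (A^t* *m A) 0 i)
  = sqrtC (1 - `|inner u v| ^+ 2) *+ 2.
Proof.
move=> u1 v1 A.
pose U := u *m u^t*; pose V := v *m v^t*; set s := 1 - _.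
have UU : U *m U = U.
  by rewrite /U -mulmxA (mulmxA _ u) inner_scalar u1 mul1mx.
have VV : V *m V = V.
  by rewrite /V -mulmxA (mulmxA _ v) inner_scalar v1 mul1mx.
have UVU : U *m V *m U = `|inner u v| ^+ 2 *: U.
  rewrite /U /V -!mulmxA (mulmxA (u^t*) v) (mulmxA (v^t*) u) !inner_scalar.
  by rewrite !mul_scalar_mx -!scalemxAr scalerA normCK inner_conj.
have VUV : V *m U *m V = `|inner u v| ^+ 2 *: V.
  rewrite /U /V -!mulmxA (mulmxA (v^t*) u) (mulmxA (u^t*) v) !inner_scalar.
  by rewrite !mul_scalar_mx -!scalemxAr scalerA normCK inner_conj mulrC.
have Aadj : A^t* = A.
  by rewrite /A adjmxD adjmxN !adjmx_mul !adjmxK.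
have AAE : A *m A = U + V - U *m V - V *m U.
  rewrite /A -/U -/V mulmxBl !mulmxBr UU VV opprB.
  by rewrite addrA [U - _ + V]addrAC.
have A3 : A *m A *m A = s *: A.
  rewrite AAE /A -/U -/V mulmxBr !mulmxBl !mulmxDl UVU VUV UU VV.
  rewrite -(mulmxA V U U) -(mulmxA U V V) UU VV /s scalerBl scale1r scalerBr.
  set a := U *m V; set b := V *m U; set x := _ *: U; set y := _ *: V.
  apply/matrixP => i j; rewrite !mxE; ring.
rewrite Aadj; apply: sum_sqrt_spectral_diag.
- by apply/normalmxP; rewrite adjmx_mul Aadj.
- exact: inner1_subr_ge0.
(* One more factor [A] turns [A^3 = s A] into [B^2 = s B] for [B = A^2]. *)
- by rewrite mulmxA A3 -scalemxAl.
- rewrite AAE !raddfB/= mxtraceD.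
  have trU : \tr U = 1 by rewrite /U mxtrace_mulC inner_scalar u1 mxtrace1.
  have trV : \tr V = 1 by rewrite /V mxtrace_mulC inner_scalar v1 mxtrace1.
  rewrite (mxtrace_mulC V) trU trV mxtrace_projectors /s; ring.
Qed.

(** Since [q] is purely imaginary, the adjoint only flips the sign of the [X] term, and
    [(p + q X) (p - q X) = p^2 - q^2]. With [p] and [q] not normalized, this covers a rotation as
    well as a difference of two rotations. *)
Lemma adjmx_mul_rot k (X : 'M[C]_k) p q : X^t* = X -> X *m X = 1%:M ->
  p^* = p -> q^* = - q ->
  (p *: 1%:M - q *: X)^t* *m (p *: 1%:M - q *: X) = (p ^+ 2 - q ^+ 2)%:M.
Proof.
move=> Xa XX pp qq; rewrite adjmxD adjmxN !adjmxZ adjmx1 Xa pp qq.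
rewrite mulmxBl !mulmxBr -!scalemxAl -!scalemxAr !mul1mx mulmx1 XX !scalerA.
rewrite !mulNr !scaleNr -opprD opprK (mulrC q p) addrA subrK.
by rewrite -scalerBl -!expr2 scalemx1.
Qed.

End hermitian_space.

(** * Lipschitz dependence of the circuit on its parameters *)

Section bits.
Local Open Scope sesquilinear_scope.
Context {R : realType} {n : nat}.
Local Notation C := (Cplx R).
Implicit Types (a b c : 'I_(qdim n)) (q : nat) (U V : 'M[C]_2).

Lemma bit_inj a b : (forall k : 'I_n, bit a k = bit b k) -> a = b.
Proof.
move=> ab; apply: enum_val_inj; apply: eq_from_tnth => k.
by rewrite !(tnth_nth 0); exact: ab.
Qed.

Definition set_bit a q (x : 'I_2) : 'I_(qdim n) :=
  enum_rank [tuple if val i == q then x else bit a i | i < n].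

Lemma bit_set_bit a q x (k : 'I_n) :
  bit (set_bit a q x) k = if val k == q then x else bit a k.
Proof. by rewrite {1}/bit /set_bit enum_rankK -tnth_nth tnth_mktuple. Qed.

Definition agree_off q a b : bool :=
  [forall k : 'I_n, (k != q :> nat) ==> (bit a k == bit b k)].

Lemma agree_offP q a b :
  reflect (forall k : 'I_n, k != q :> nat -> bit a k = bit b k)
          (agree_off q a b).
Proof.
apply: (iffP forallP) => [ab k kq|ab k].
  by apply/eqP; have /implyP := ab k; exact.
by apply/implyP => kq; apply/eqP; exact: ab.
Qed.

Lemma agree_off_sym q a b : agree_off q a b = agree_off q b a.
Proof. by apply/agree_offP/agree_offP => ab k kq; rewrite ab. Qed.

Lemma agree_off_trans q a b c :
  agree_off q a b -> agree_off q b c -> agree_off q a c.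
Proof.
move=> /agree_offP ab /agree_offP bc; apply/agree_offP => k kq.
by rewrite ab ?bc.
Qed.

Lemma agree_off_eq q a b : (q < n)%N ->
  (a == b) = (bit a q == bit b q) && agree_off q a b.
Proof.
move=> qn; apply/eqP/andP => [->|[/eqP ab /agree_offP abq]].
  by split=> //; apply/agree_offP.
apply: bit_inj => k; have [kq|] := eqVneq (val k) q; last exact: abq.
by rewrite -kq in ab.
Qed.

Lemma on_qubitE q U a b :
  on_qubit n q U a b = U (bit a q) (bit b q) * (agree_off q a b)%:R.
Proof. by rewrite mxE. Qed.

Lemma on_qubitM q U V : (q < n)%N ->
  on_qubit n q U *m on_qubit n q V = on_qubit n q (U *m V).
Proof.
move=> qn; apply/matrixP => a c; rewrite on_qubitE !mxE.
have [ac|ac] := boolP (agree_off q a c); last first.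
  rewrite mulr0 big1// => b _; rewrite !on_qubitE.
  have [ab|] := boolP (agree_off q a b); last by rewrite mulr0 mul0r.
  have [bc|] := boolP (agree_off q b c); last by rewrite !mulr0.
  by rewrite (agree_off_trans ab bc) in ac.
rewrite mulr1 (bigID (agree_off q a))/= addrC big1 ?add0r; last first.
  by move=> b /negbTE ab; rewrite !on_qubitE ab mulr0 mul0r.
have bit_set x : bit (set_bit a q x) q = x.
  by have := bit_set_bit a q x (Ordinal qn); rewrite /= eqxx.
(* An intermediate index [b] that agrees with [a] off [q] is determined by its bit [q], so the sum
   over ['I_(qdim n)] becomes the sum over ['I_2] of the 2 by 2 product. *)
rewrite (reindex_onto (set_bit a q) (fun b => bit b q))/=; last first.
  move=> b /agree_offP ab; apply: bit_inj => k; rewrite bit_set_bit.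
  by case: eqVneq => [->//|kq]; rewrite ab.
apply: eq_big => [x|x _].
  rewrite bit_set eqxx andbT; apply/agree_offP => k kq.
  by rewrite bit_set_bit (negbTE kq).
have ax : agree_off q a (set_bit a q x).
  by apply/agree_offP => k kq; rewrite bit_set_bit (negbTE kq).
rewrite !on_qubitE bit_set ax (agree_off_trans _ ac) ?mulr1//.
by rewrite agree_off_sym.
Qed.

Lemma on_qubitD q U V : on_qubit n q (U + V) = on_qubit n q U + on_qubit n q V.
Proof. by apply/matrixP => a b; rewrite !mxE mulrDl. Qed.

Lemma on_qubitZ q z U : on_qubit n q (z *: U) = z *: on_qubit n q U.
Proof. by apply/matrixP => a b; rewrite !mxE mulrA. Qed.

Lemma on_qubitB q U V : on_qubit n q (U - V) = on_qubit n q U - on_qubit n q V.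
Proof. by rewrite -scaleN1r on_qubitD on_qubitZ scaleN1r. Qed.

Lemma on_qubit1 q : (q < n)%N -> on_qubit n q 1%:M = 1%:M :> 'M[C]_(qdim n).
Proof.
move=> qn; apply/matrixP => a b.
by rewrite on_qubitE !mxE (agree_off_eq _ _ qn) -mulnb natrM.
Qed.

Lemma on_qubit_adj q U : (on_qubit n q U)^t* = on_qubit n q (U^t*).
Proof.
apply/matrixP => a b; rewrite on_qubitE !mxE -/(agree_off q b a).
by rewrite rmorphM/= conjC_nat agree_off_sym.
Qed.

Lemma on_qubit_isometry q U : (q < n)%N ->
  isometry_mx U -> isometry_mx (on_qubit n q U).
Proof.
by move=> qn UU; rewrite /isometry_mx on_qubit_adj on_qubitM// UU on_qubit1.
Qed.

Lemma on_qubit_diag q (d : 'rV[C]_2) : (q < n)%N ->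
  on_qubit n q (diag_mx d) = diag_mx (\row_a d 0 (bit a q)).
Proof.
move=> qn; apply/matrixP => a b; rewrite on_qubitE !mxE (agree_off_eq _ _ qn).
rewrite -mulnb mulrnA.
by case: (agree_off q a b); rewrite /= ?mulr0 ?mulr1 ?mul0r.
Qed.

(** An entry of the operator on [q'] vanishes unless its two indices agree on qubit [q], so the
    diagonal factor takes the same value at both. The diagonal case is the one of the control
    projectors in [cnot]. *)
Lemma on_qubit_diag_comm q q' (d : 'rV[C]_2) U : (q < n)%N -> q != q' ->
  on_qubit n q (diag_mx d) *m on_qubit n q' U
  = on_qubit n q' U *m on_qubit n q (diag_mx d).
Proof.
move=> qn qq'; rewrite on_qubit_diag// mul_diag_mx mul_mx_diag.
apply/matrixP => a b; rewrite mxE [RHS]mxE on_qubitE !mxE.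
have [/agree_offP ab|] := boolP (agree_off q' a b); last first.
  by rewrite !mulr0 mul0r.
by rewrite (ab (Ordinal qn))// mulrC.
Qed.

End bits.

Lemma pauliX2 {R : realType} : (@pauliX R) *m pauliX = 1%:M.
Proof.
apply/matrixP => i j; rewrite !mxE !big_ord_recl big_ord0 !mxE/=.
case: i => [[|[|//]] i2]; case: j => [[|[|//]] j2];
  by rewrite /= ?mulr0 ?mul0r ?mulr1 ?addr0 ?add0r.
Qed.

Section isometries.
Local Open Scope sesquilinear_scope.
Context {R : realType}.
Local Notation C := (Cplx R).

Lemma pauliX_adj : (@pauliX R)^t* = pauliX.
Proof. by apply/matrixP => i j; rewrite !mxE conjC_nat eq_sym. Qed.

(** With [P0], [P1] the complementary projectors of the control and [X] the flip of the target, the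
    product is [(P0 + X P1) (P0 + P1 X) = P0 + X P1 X = P0 + P1]. Moving [X] across [P1] uses that
    control and target differ, that is [0 < i]. *)
Lemma cnot_isometry n i : (0 < i < n)%N -> isometry_mx (@cnot R n i).
Proof.
move=> /andP[i0 iN]; have n0 : (0 < n)%N by exact: ltn_trans iN.
have dE (j : 'I_2) : delta_mx j j = diag_mx (delta_mx 0 j) :> 'M[C]_2.
  apply/matrixP => a b; rewrite !mxE eqxx/=.
  have [->|ab] := eqVneq a b; first by rewrite andbb mulr1n.
  by rewrite mulr0n; case: eqVneq => //= aj; rewrite -aj eq_sym (negbTE ab).
pose P0 := on_qubit n 0 (delta_mx 0 0 : 'M[C]_2).
pose P1 := on_qubit n 0 (delta_mx 1 1 : 'M[C]_2).
pose X := on_qubit n i (@pauliX R).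
have dadj (j : 'I_2) : (delta_mx j j : 'M[C]_2)^t* = delta_mx j j.
  by apply/matrixP => a b; rewrite !mxE conjC_nat andbC.
have P0a : P0^t* = P0 by rewrite on_qubit_adj dadj.
have P1a : P1^t* = P1 by rewrite on_qubit_adj dadj.
have Xa : X^t* = X by rewrite on_qubit_adj pauliX_adj.
have XX : X *m X = 1%:M by rewrite on_qubitM// pauliX2 on_qubit1.
have XP : P1 *m X = X *m P1.
  by rewrite /P1 dE; apply: on_qubit_diag_comm => //; rewrite eq_sym -lt0n.
have P00 : P0 *m P0 = P0 by rewrite on_qubitM// mul_delta_mx.
have P11 : P1 *m P1 = P1 by rewrite on_qubitM// mul_delta_mx.
have q0 : on_qubit n 0 (0 : 'M[C]_2) = 0.
  by apply/matrixP => a b; rewrite !mxE mul0r.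
have P01 : P0 *m P1 = 0 by rewrite on_qubitM// mul_delta_mx_0.
have P10 : P1 *m P0 = 0 by rewrite on_qubitM// mul_delta_mx_0.
have PD : P0 + P1 = 1%:M.
  rewrite -on_qubitD -(on_qubit1 n0); congr on_qubit; apply/matrixP => a b.
  rewrite !mxE; case: a => [[|[|//]] a2]; case: b => [[|[|//]] b2];
  by rewrite /= ?addr0 ?add0r.
rewrite /isometry_mx /cnot -/P0 -/P1 -/X adjmxD adjmx_mul P0a P1a Xa.
rewrite mulmxDl !mulmxDr P00 mulmxA P01 mul0mx addr0 -(mulmxA X P1 P0) P10.
by rewrite mulmx0 add0r mulmxA -(mulmxA X P1 P1) P11 -XP -mulmxA XX mulmx1.
Qed.

Lemma hadamard_isometry : isometry_mx (@hadamard R).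
Proof.
have s2 : sqrtC 2 * sqrtC 2 = 2 :> C by rewrite -expr2 sqrtCK.
have s0 : sqrtC 2 != 0 :> C by rewrite sqrtC_eq0 pnatr_eq0.
have sr : (sqrtC 2)^* = sqrtC 2 :> C.
  by apply/CrealP; rewrite ger0_real// sqrtC_ge0 ler0n.
have Ha : (@hadamard R)^t* = hadamard.
  apply/matrixP => i j; rewrite !mxE mulnC rmorphM/= fmorphV/=.
  by rewrite rmorphXn rmorphN1 sr.
have two : 2 != 0 :> C by rewrite pnatr_eq0.
have h : (sqrtC 2)^-1 * (sqrtC 2)^-1 = 2^-1 :> C by rewrite -invfM s2.
have h2 : 2^-1 + 2^-1 = 1 :> C by field.
rewrite /isometry_mx Ha; apply/matrixP => i j.
rewrite !mxE !big_ord_recl big_ord0 !mxE addr0/=.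
case: i => [[|[|//]] i2]; case: j => [[|[|//]] j2];
  rewrite /= ?muln0 ?mul0n ?muln1 ?expr0 ?expr1 ?mulN1r ?mul1r ?mulrN ?mulNr h;
  by rewrite ?opprK ?subrr// h2.
Qed.

End isometries.

(** * Rotations: closed form and Lipschitz bound *)

Section rotation.
Local Open Scope sesquilinear_scope.
Context {R : realType}.
Local Notation C := (Cplx R).

Definition toC (x : R) : C := (x%:C)%C.

Lemma toCD x y : toC (x + y) = toC x + toC y.
Proof. exact: rmorphD. Qed.
Lemma toCN x : toC (- x) = - toC x.
Proof. exact: rmorphN. Qed.
Lemma toCM x y : toC (x * y) = toC x * toC y.
Proof. exact: rmorphM. Qed.
Lemma toC1 : toC 1 = 1. Proof. by []. Qed.
Lemma toC0 : toC 0 = 0. Proof. by []. Qed.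
Lemma toCV x : toC x^-1 = (toC x)^-1.
Proof. exact: (fmorphV (real_complex R)). Qed.
Lemma toCX x k : toC (x ^+ k) = toC x ^+ k.
Proof. exact: (rmorphXn (real_complex R)). Qed.
Lemma toC_nat k : toC k%:R = k%:R.
Proof. exact: (rmorph_nat (real_complex R)). Qed.
Lemma toC_sum I (r : seq I) (P : pred I) F :
  toC (\sum_(i <- r | P i) F i) = \sum_(i <- r | P i) toC (F i).
Proof. exact: (rmorph_sum (real_complex R)). Qed.
Lemma toC_norm x : `|toC x| = toC `|x|.
Proof. by rewrite normc_def/= expr0n/= addr0 sqrtr_sqr. Qed.
Lemma ler_toC x y : (toC x <= toC y) = (x <= y).
Proof. exact: lecR. Qed.
Lemma ltr_toC x y : (toC x < toC y) = (x < y).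
Proof. exact: ltcR. Qed.
Lemma Re_toC x : complex.Re (toC x) = x. Proof. by []. Qed.
Lemma toC_Re (z : C) : 0 <= z -> toC (complex.Re z) = z.
Proof. by move=> z0; apply: RRe_real; exact: ger0_real. Qed.
Lemma conj_toC x : (toC x)^* = toC x.
Proof. by apply/CrealP; rewrite complex_real. Qed.

Lemma cvg_toC (u : R^nat) l : u @ \oo --> l -> (toC \o u) @ \oo --> toC l.
Proof.
move=> ul; apply/cvgrPdist_lt => e e0.
have e0' : 0 < complex.Re e by rewrite -ltr_toC toC_Re ?ltW.
have /cvgrPdist_lt /(_ _ e0') := ul.
apply: filterS => k; rewrite -ltr_toC toC_Re ?ltW//.
by rewrite -toC_norm toCD toCN.
Qed.

(** Euler's formula: [pauliX] squares to the identity, so the even terms of the exponential series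
    add up to the cosine and the odd ones to the sine. *)
Lemma rxE (t : R) :
  rx t = toC (cos (t / 2)) *: 1%:M - ('i * toC (sin (t / 2))) *: pauliX.
Proof.
rewrite /rx /expmx; set a := - 'i * _ / 2.
have : a = - 'i * toC (t / 2) by rewrite /a toCM toCV toC_nat mulrA.
move: (t / 2) => th aE.
(* The powers of [- 'i] are put in the shape of [cos_coeff] and [sin_coeff], with one parity
   indicator per series. *)
have expi j : (- 'i : C) ^+ j =
    (~~ odd j)%:R * (-1) ^+ j./2 - 'i * ((odd j)%:R * (-1) ^+ j.-1./2).
  have even k : (- 'i : C) ^+ k.*2 = (-1) ^+ k.
    by rewrite -muln2 mulnC exprM sqrrN sqrCi.
  have [oj|ej] := boolP (odd j); rewrite /= ?mul0r ?mul1r ?mulr0 ?subr0 ?sub0r.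
    rewrite -{1}(odd_double_half j) oj add1n exprS even mulNr.
    congr (- (_ * _ ^+ _)); case: j oj => //= j.
    by rewrite uphalf_half => /negbTE ->.
  by rewrite -{1}(odd_double_half j) (negbTE ej) add0n even.
have Xj j : (@pauliX R) ^+ j = if odd j then pauliX else 1.
  elim: j => [|j ih]; first by rewrite expr0.
  by rewrite exprS ih /=; case: odd; rewrite /= ?mulr1// -mulmxE pauliX2.
have term j : (j`!)%:R^-1 *: (a *: pauliX) ^+ j =
    toC (cos_coeff th j) *: 1%:M - ('i * toC (sin_coeff th j)) *: pauliX
    :> 'M[C]_2.
  rewrite exprZn aE exprMn expi Xj /cos_coeff /sin_coeff/=.
  rewrite !toCM !toCV !toCX !toC_nat !toCN toC1.
  case: (odd j); rewrite /= ?mul0r ?mul1r ?mulr0 ?subr0 ?sub0r ?scale0r.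
    rewrite sub0r -[RHS]scaleNr scalerA.
    by apply: (congr1 (fun z => z *: pauliX)); ring.
  by rewrite subr0 scalerA; apply: (congr1 (fun z => z *: 1%:M)); ring.
have -> : (fun j => (j`!)%:R^-1 *: (a *: pauliX) ^+ j) = (fun j =>
  toC (cos_coeff th j) *: 1%:M - ('i * toC (sin_coeff th j)) *: pauliX
  :> 'M[C]_2).
  by apply/funext => j; exact: term.
apply/cvg_lim; first exact: norm_hausdorff.
have -> : series (fun j =>
  toC (cos_coeff th j) *: 1%:M - ('i * toC (sin_coeff th j)) *: pauliX) =
  (fun k => toC (series (cos_coeff th) k) *: 1%:M -
   ('i * toC (series (sin_coeff th) k)) *: pauliX :> 'M[C]_2).
  apply/funext => k; rewrite /series/= sumrB -scaler_suml toC_sum.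
  by rewrite -scaler_suml -mulr_sumr toC_sum.
apply: (@cvgB C 'M[C]_2); apply: (@cvgZr_tmp C 'M[C]_2).
  by apply: cvg_toC; rewrite unlock; exact: is_cvg_series_cos_coeff.
apply: cvgMl_tmp; apply: cvg_toC; rewrite unlock.
exact: is_cvg_series_sin_coeff.
Qed.

Lemma rot_adj_mul (a b : R) (M : 'M[C]_2) :
  M = toC a *: 1%:M - ('i * toC b) *: pauliX ->
  M^t* *m M = (toC (a ^+ 2 + b ^+ 2))%:M.
Proof.
move->; rewrite (adjmx_mul_rot pauliX_adj pauliX2 (conj_toC a)).
  by rewrite exprMn sqrCi mulN1r opprK toCD !toCX.
by rewrite rmorphM/= conjCi conj_toC mulNr.
Qed.

Lemma rx_isometry (t : R) : isometry_mx (rx t).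
Proof. by rewrite /isometry_mx (rot_adj_mul (rxE t)) cos2Dsin2. Qed.

Lemma lipschitz_of_derive (f df : R -> R) :
  (forall x : R, is_derive x 1 f (df x)) -> (forall x, `|df x| <= 1) ->
  forall s t, `|f s - f t| <= `|s - t|.
Proof.
move=> fdf df1 s t; wlog st : s t / t <= s.
  move=> h; case/orP: (le_total t s) => /h//.
  by move=> fts; rewrite (distrC (f s)) (distrC s).
have cf : {within `[t, s], continuous f}.
  apply: continuous_subspaceT => x; apply/differentiable_continuous.
  by apply/derivable1_diffP; have [] := fdf x.
have [c _ ->] := @MVT_segment R f df t s st (fun x _ => fdf x) cf.
by rewrite normrM ler_piMl.
Qed.

(** The difference of two rotations is again [a - i b X] with real [a] and [b], so it scales norms
    by exactly [sqrt (a^2 + b^2)]. Here [a] and [b] are differences of cosines and sines of half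
    angles, each at most [|s - t| / 2] in absolute value; the resulting [|s - t| / sqrt 2] is
    rounded up. *)
Lemma rx_close n q (s t : R) : (q < n)%N ->
  close_mx (toC `|s - t|) (on_qubit n q (rx s)) (on_qubit n q (rx t)).
Proof.
move=> qn v; rewrite -mulmxBl -on_qubitB !rxE.
pose a := cos (s / 2) - cos (t / 2); pose b := sin (s / 2) - sin (t / 2).
rewrite [X in on_qubit _ _ X](_ : _ = toC a *: 1%:M - ('i * toC b) *: pauliX);
    last first.
  rewrite /a /b !toCD !toCN; move: (toC _) (toC _) (toC _) (toC _) => x y z w.
  by apply/matrixP => i j; rewrite !mxE; ring.
rewrite (@vnorm_mul_scalar _ _ _ (toC (a ^+ 2 + b ^+ 2))); last 2 first.
- rewrite on_qubit_adj on_qubitM// (rot_adj_mul erefl).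
  by rewrite -[X in on_qubit _ _ X]scalemx1 on_qubitZ on_qubit1// scalemx1.
- by rewrite -toC0 ler_toC addr_ge0// sqr_ge0.
rewrite ler_wpM2r ?vnorm_ge0// -[leRHS]sqrCK; last first.
  by rewrite -toC0 ler_toC.
rewrite ler_sqrtC ?qualifE/= -?toC0 -?toCX ?ler_toC ?addr_ge0 ?sqr_ge0//.
have half_le (u : R) : `|u| <= `|s / 2 - t / 2| -> u ^+ 2 <= `|s - t| ^+ 2 / 4.
  move=> h; rewrite -real_normK ?num_real//.
  have -> : `|s - t| ^+ 2 / 4 = `|s / 2 - t / 2| ^+ 2.
    rewrite -mulrBl normrM exprMn; congr (_ * _).
    by rewrite ger0_norm//; field.
  by rewrite lerXn2r ?nnegrE.
have ha : a ^+ 2 <= `|s - t| ^+ 2 / 4.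
  apply/half_le/(@lipschitz_of_derive _ (fun x => - sin x)) => x.
  by rewrite normrN sin_max.
have hb : b ^+ 2 <= `|s - t| ^+ 2 / 4.
  by apply/half_le/(@lipschitz_of_derive _ cos) => x; exact: cos_max.
have := sqr_ge0 `|s - t|.
lra.
Qed.

End rotation.

(** * Error propagation through gates, blocks and layers *)

Section circuit_close.
Context {R : realType}.
Local Notation C := (Cplx R).

(** Additive error bounds for products need isometries on both sides; bundling them with closeness
    gives a relation stable under products. *)
Definition near_iso k (e : C) (A B : 'M[C]_k) :=
  [/\ isometry_mx A, isometry_mx B & close_mx e A B].

Lemma near_iso_refl k (A : 'M[C]_k) : isometry_mx A -> near_iso 0 A A.
Proof. by move=> AA; split => //; exact: close_mx0. Qed.

Lemma near_isoM k e e' (A B A' B' : 'M[C]_k) : near_iso e A B ->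
  near_iso e' A' B' -> near_iso (e + e') (A *m A') (B *m B').
Proof.
move=> [AA BB AB] [AA' BB' AB']; split; last exact: close_mxM.
  exact: isometry_mxM.
exact: isometry_mxM.
Qed.

Lemma near_iso_prod k (I : eqType) e (s : seq I) (F G : I -> 'M[C]_k) :
  (forall i, i \in s -> near_iso e (F i) (G i)) ->
  near_iso (e *+ size s) (\prod_(i <- s) F i) (\prod_(i <- s) G i).
Proof.
elim: s => [|i s ih] FG.
  by rewrite !big_nil mulr0n; exact/near_iso_refl/isometry_mx1.
rewrite !big_cons /= mulrS; apply: near_isoM; first exact/FG/mem_head.
by apply: ih => j js; apply: FG; rewrite in_cons js orbT.
Qed.

(** Only the three rotations differ between the two sides; the Hadamard factors are common and
    contribute error [0]. *)
Lemma gate_near n q (H A B D A' B' D' : 'M[C]_2) e : (q < n)%N ->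
  isometry_mx H ->
  near_iso e (on_qubit n q A) (on_qubit n q A') ->
  near_iso e (on_qubit n q B) (on_qubit n q B') ->
  near_iso e (on_qubit n q D) (on_qubit n q D') ->
  near_iso (e *+ 3) (on_qubit n q (H *m A *m H *m B *m H *m D *m H))
    (on_qubit n q (H *m A' *m H *m B' *m H *m D' *m H)).
Proof.
move=> qn HH AA BB DD; rewrite -!(on_qubitM _ _ qn).
have HHH : near_iso 0 (on_qubit n q H) (on_qubit n q H).
  exact/near_iso_refl/on_qubit_isometry.
have -> : e *+ 3 = 0 + e + 0 + e + 0 + e + 0.
  by rewrite !addr0 add0r -mulr2n -mulrSr.
by do 6 apply: near_isoM => //.
Qed.

Lemma gate1_near n q (t t' : 'I_3 -> R) (e : R) : (q < n)%N ->
  (forall p, `|t p - t' p| <= e) ->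
  near_iso (toC e *+ 3) (on_qubit n q (gate1 t)) (on_qubit n q (gate1 t')).
Proof.
move=> qn tt'.
have X p :
    near_iso (toC e) (on_qubit n q (rx (t p))) (on_qubit n q (rx (t' p))).
  split; [exact/on_qubit_isometry/rx_isometry..|move=> v].
  apply: le_trans (rx_close _ _ qn v) _.
  by rewrite ler_wpM2r ?vnorm_ge0// ler_toC.
exact (gate_near qn hadamard_isometry (X 0) (X 1) (X 2)).
Qed.

Lemma conj_near n (K A B D E A' B' D' E' : 'M[C]_(qdim n)) e :
  isometry_mx K -> near_iso e A A' -> near_iso e B B' ->
  near_iso e D D' -> near_iso e E E' ->
  near_iso (e *+ 4) (K *m (A *m B) *m K *m (D *m E))
    (K *m (A' *m B') *m K *m (D' *m E')).
Proof.
move=> KK AA BB DD EE; have KKK := near_iso_refl KK.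
have -> : e *+ 4 = 0 + (e + e) + 0 + (e + e).
  by rewrite add0r addr0 -!mulr2n -mulrnA.
by do ![apply: near_isoM => //].
Qed.

(** Twelve rotations per block: four level-1 gates with three angles each. The two CNOT factors are
    common to both sides. *)
Lemma block_near n i (t t' : 'I_4 -> 'I_3 -> R) (e : R) : (0 < i < n)%N ->
  (forall k p, `|t k p - t' k p| <= e) ->
  near_iso (toC e *+ 12) (block n i t) (block n i t').
Proof.
move=> i0n tt'; have /andP[i0 iN] := i0n.
have n0 : (0 < n)%N by exact: ltn_trans iN.
rewrite (mulrnA _ 3 4).
exact (conj_near (cnot_isometry i0n)
  (gate1_near n0 (tt' 2)) (gate1_near iN (tt' 3))
  (gate1_near n0 (tt' 0)) (gate1_near iN (tt' 1))).
Qed.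

Lemma layer_near n (t t' : nat -> 'I_4 -> 'I_3 -> R) (e : R) :
  (forall i k p, (i < n)%N -> `|t i k p - t' i k p| <= e) ->
  near_iso (toC e *+ (12 * n.-1)) (layer n t) (layer n t').
Proof.
move=> tt'; rewrite mulrnA.
have sz : n.-1 = size (rev (iota 1 n.-1)) by rewrite size_rev size_iota.
rewrite [X in near_iso (_ *+ X)]sz {sz}.
apply: near_iso_prod => i; rewrite mem_rev mem_iota add1n => /andP[i0 iN].
have i0n : (0 < i < n)%N by case: n iN {tt'} => [|n]; case: i i0.
by apply: block_near => // k p; apply: tt'; case/andP: i0n.
Qed.

Lemma circuit_near n d (t t' : nat -> nat -> 'I_4 -> 'I_3 -> R) (e : R) :
  (forall l i k p, (l < d)%N -> (i < n)%N -> `|t l i k p - t' l i k p| <= e) ->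
  near_iso (toC e *+ (12 * n.-1 * d)) (circuit n d t) (circuit n d t').
Proof.
move=> tt'; rewrite mulrnA /circuit.
rewrite [X in near_iso (_ *+ X)](_ : d = size (index_enum 'I_d)); last first.
  by rewrite -sum1_size big_const_ord iter_addn_0 mul1n.
by apply: near_iso_prod => l _; apply: layer_near => i k p; apply: tt'.
Qed.

End circuit_close.

(** * The trace-distance loss *)

Section complex_measurable.
Context {R : realType} d (T : measurableType d).
Local Notation C := (Cplx R).
Implicit Types f g : T -> C.

Definition cmeasurable f :=
  measurable_fun setT (fun x => complex.Re (f x)) /\
  measurable_fun setT (fun x => complex.Im (f x)).

Lemma cmeasurable_cst z : cmeasurable (fun=> z).
Proof. by split; exact: measurable_cst. Qed.

Lemma cmeasurableD f g :
  cmeasurable f -> cmeasurable g -> cmeasurable (fun x => f x + g x).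
Proof.
move=> [rf jf] [rg jg]; split.
  rewrite (_ : (fun _ => _) =
    (fun x => complex.Re (f x)) \+ (fun x => complex.Re (g x))).
    exact: measurable_funD.
  by apply/funext => x /=; case: (f x) (g x) => [? ?] [? ?].
rewrite (_ : (fun _ => _) =
  (fun x => complex.Im (f x)) \+ (fun x => complex.Im (g x))).
  exact: measurable_funD.
by apply/funext => x /=; case: (f x) (g x) => [? ?] [? ?].
Qed.

Lemma cmeasurableM f g :
  cmeasurable f -> cmeasurable g -> cmeasurable (fun x => f x * g x).
Proof.
move=> [rf jf] [rg jg]; split.
  rewrite (_ : (fun _ => _) =
    ((fun x => complex.Re (f x)) \* (fun x => complex.Re (g x))) \-
    ((fun x => complex.Im (f x)) \* (fun x => complex.Im (g x)))).
    by apply: measurable_funB; exact: measurable_funM.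
  by apply/funext => x /=; case: (f x) (g x) => [? ?] [? ?].
rewrite (_ : (fun _ => _) =
  ((fun x => complex.Re (f x)) \* (fun x => complex.Im (g x))) \+
  ((fun x => complex.Im (f x)) \* (fun x => complex.Re (g x)))).
  by apply: measurable_funD; exact: measurable_funM.
by apply/funext => x /=; case: (f x) (g x) => [? ?] [? ?].
Qed.

Lemma cmeasurable_sum I (r : seq I) (f : I -> T -> C) :
  (forall i, cmeasurable (f i)) -> cmeasurable (fun x => \sum_(i <- r) f i x).
Proof.
move=> mf; elim: r => [|i r ih].
  rewrite (_ : (fun _ => _) = fun=> 0); first exact: cmeasurable_cst.
  by apply/funext => x; rewrite big_nil.
rewrite (_ : (fun _ => _) = fun x => f i x + \sum_(j <- r) f j x).
  exact: cmeasurableD.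
by apply/funext => x; rewrite big_cons.
Qed.

Lemma cmeasurable_mulmx m n p (A : T -> 'M[C]_(m, n)) (B : T -> 'M[C]_(n, p)) :
  (forall i j, cmeasurable (fun x => A x i j)) ->
  (forall i j, cmeasurable (fun x => B x i j)) ->
  forall i j, cmeasurable (fun x => (A x *m B x) i j).
Proof.
move=> mA mB i j.
rewrite (_ : (fun _ => _) = fun x => \sum_k A x i k * B x k j).
  by apply: cmeasurable_sum => k; exact: cmeasurableM.
by apply/funext => x; rewrite mxE.
Qed.

End complex_measurable.

Lemma cmeasurable_comp {R : realType} d d' (T : measurableType d)
    (T' : measurableType d') (f : T' -> Cplx R) (h : T -> T') :
  cmeasurable f -> measurable_fun setT h -> cmeasurable (f \o h).
Proof.
move=> [rf jf] mh; split; first exact: (measurableT_comp rf).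
exact: (measurableT_comp jf).
Qed.

Section sqrt_estimates.
Context {R : realType}.

(** For [b <= a], squaring [sqrt a <= sqrt (a - b) + sqrt b] leaves only a nonnegative cross term on
    the right. *)
Lemma ler_dist_sqrt (a b : R) : 0 <= a -> 0 <= b ->
  `|Num.sqrt a - Num.sqrt b| <= Num.sqrt `|a - b|.
Proof.
move=> a0 b0; wlog ba : a b a0 b0 / b <= a.
  move=> h; case/orP: (le_total b a) => ab; first exact: h.
  by rewrite (distrC (Num.sqrt a)) (distrC a); exact: h.
rewrite !ger0_norm ?subr_ge0 ?ler_sqrt// lerBlDr.
rewrite -ler_sqr ?nnegrE ?addr_ge0 ?sqrtr_ge0//.
rewrite sqrrD !sqr_sqrtr ?subr_ge0//.
by have := mulr_ge0 (sqrtr_ge0 (a - b)) (sqrtr_ge0 b); lra.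
Qed.

Lemma ler_dist_sqrt_1Bsqr (a b e : R) : 0 <= a <= 1 -> 0 <= b <= 1 ->
  `|a - b| <= e ->
  `|Num.sqrt (1 - a ^+ 2) - Num.sqrt (1 - b ^+ 2)| <= Num.sqrt (2 * e).
Proof.
move=> /andP[a0 a1] /andP[b0 b1] abe.
rewrite (le_trans (ler_dist_sqrt _ _)) ?subr_ge0 ?exprn_ile1//.
rewrite ler_sqrt ?mulr_ge0 ?(le_trans _ abe)//.
(* The factor [b + a] is at most [2], which is the [2] under the root. *)
have -> : 1 - a ^+ 2 - (1 - b ^+ 2) = (b + a) * (b - a) by ring.
rewrite normrM ler_pM// 1?distrC// ger0_norm ?addr_ge0//.
lra.
Qed.

End sqrt_estimates.

(** * Measurability and stability of the loss on pure states *)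

Section pure_state_theory.
Local Open Scope sesquilinear_scope.
Local Open Scope quotient_scope.
Context {R : realType} {n : nat}.
Local Notation C := (Cplx R).
Implicit Types x y : pure_state R n.

Lemma psi_unit x : inner (psi x) (psi x) = 1.
Proof.
by rewrite inner_normE; exact: (set_valP (repr (x : state_space n))).
Qed.

Lemma vnorm_psi x : vnorm (psi x) = 1.
Proof. by rewrite /vnorm psi_unit sqrtC1. Qed.

Lemma continuous_Re : continuous (@complex.Re R : C -> R).
Proof.
move=> z; apply/(@cvgrPdist_lt _ _ _ (nbhs z) _) => e e0.
have e0' : 0 < toC e by rewrite -toC0 ltr_toC.
have /(@cvgrPdist_lt _ C _ (nbhs z) _ id z) /(_ _ e0') := @cvg_id _ (nbhs z).
apply: filterS => w h; rewrite -ltr_toC; apply: le_lt_trans h.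
rewrite -raddfB; exact: normc_ge_Re.
Qed.

Lemma continuous_Im : continuous (@complex.Im R : C -> R).
Proof.
move=> z; apply/(@cvgrPdist_lt _ _ _ (nbhs z) _) => e e0.
have e0' : 0 < toC e by rewrite -toC0 ltr_toC.
have /(@cvgrPdist_lt _ C _ (nbhs z) _ id z) /(_ _ e0') := @cvg_id _ (nbhs z).
apply: filterS => w h; rewrite -ltr_toC; apply: le_lt_trans h.
rewrite -raddfB normc_def lecR -sqrtr_sqr ler_wsqrtr// lerDr.
exact: sqr_ge0.
Qed.

Lemma continuous_conjC : continuous (Num.conj : C -> C).
Proof.
move=> z; apply/(@cvgrPdist_lt _ _ _ (nbhs z) _) => e e0.
have /(@cvgrPdist_lt _ C _ (nbhs z) _ id z) /(_ _ e0) := @cvg_id _ (nbhs z).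
by apply: filterS => w h; rewrite -rmorphB norm_conjC.
Qed.

Lemma continuous_measurable_pure_state (f : state_space n -> R) :
  continuous f -> measurable_fun setT (f : pure_state R n -> R).
Proof.
move=> /continuousP cf; apply: (measurability _ (RGenOpens.measurableE R)).
move=> _ [_ [a [b ->] <-]]; rewrite setTI; apply: sub_sigma_algebra.
exact/cf/interval_open.
Qed.

(** [psi x] depends on a choice of representative but the projector does not: a phase [z]
    contributes [|z|^2 = 1]. Each entry is thus a continuous function on the sphere that descends to
    the quotient. *)
Lemma cmeasurable_projector i j :
  cmeasurable (fun x => (psi x *m (psi x)^t*) i j).
Proof.
pose g (u : @unit_vectors R n) : C := (val u *m (val u)^t*) i j.
have cg : continuous g.
  rewrite (_ : g =
    (fun w : 'cV[C]_(qdim n) => w i 0 * (w j 0)^* : C) \o set_val).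
    move=> u; apply: continuous_comp; first exact: initial_continuous.
    have cc k : continuous (fun w : 'cV[C]_(qdim n) => w k 0).
      exact: coord_continuous.
    apply: (@cvgM C _ (nbhs (set_val u)) _); first exact: (cc i (set_val u)).
    exact: (continuous_comp (cc j (set_val u)) (@continuous_conjC _)).
  by apply/funext => u; rewrite /g mxE big_ord1 !mxE.
have gE (a b : @unit_vectors R n) :
    \pi_(state_space n) a == \pi_(state_space n) b -> g a = g b.
  move=> /eqP ab0.
  have /eqmodP/asboolP[z z1 ab] : a = b %[mod {eq_quot (@phase_equiv_rel R n)}].
    exact: ab0.
  rewrite /g ab linearZ/= map_mxZ -scalemxAl -scalemxAr scalerA -normCK z1.
  by rewrite expr1n scale1r.
split.
- apply: continuous_measurable_pure_state.
  apply: (@repr_comp_continuous _ _ _ (fun u => complex.Re (g u))).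
    by move=> u; apply: continuous_comp; [exact: cg|exact: continuous_Re].
  by move=> a b /gE ->.
- apply: continuous_measurable_pure_state.
  apply: (@repr_comp_continuous _ _ _ (fun u => complex.Im (g u))).
    by move=> u; apply: continuous_comp; [exact: cg|exact: continuous_Im].
  by move=> a b /gE ->.
Qed.

Lemma trace_distE x y : trace_dist R n x y =
  Num.sqrt (1 - complex.Re (`|inner (psi x) (psi y)| ^+ 2)).
Proof.
have s0 := inner1_subr_ge0 (psi_unit x) (psi_unit y).
rewrite /trace_dist /trace_norm.
rewrite (sum_sqrt_spectral_diag_pure (psi_unit x) (psi_unit y)).
set r := 1 - complex.Re _.
have rE : 1 - `|inner (psi x) (psi y)| ^+ 2 = toC r :> C.
  by rewrite /r toCD toCN toC_Re ?exprn_ge0.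
have r0 : 0 <= r by rewrite -ler_toC -rE.
rewrite rE -{1}(sqr_sqrtr r0) toCX sqrCK -?toC0 ?ler_toC ?sqrtr_ge0//.
rewrite (_ : _ *+ 2 = toC (Num.sqrt r *+ 2)); last by rewrite !mulr2n toCD.
by rewrite Re_toC; field.
Qed.

(** The loss of sending [z.1] through [A] when [z.2] is expected. Taking a matrix instead of a map
    of states lets grid circuits be compared without choosing output states; global phases drop out
    of the modulus. *)
Definition overlap_loss (A : 'M[C]_(qdim n))
    (z : pure_state R n * pure_state R n) : R :=
  Num.sqrt (1 - complex.Re (`|inner (psi z.2) (A *m psi z.1)| ^+ 2)).

Lemma trace_dist_phase A x y y' : phase_equiv (psi y') (A *m psi x) ->
  trace_dist R n y y' = overlap_loss A (x, y).
Proof.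
by move=> [z z1 e]; rewrite trace_distE /overlap_loss e innerZr normrM z1 mul1r.
Qed.

(** [Num.sqrt] is [0] on negative numbers, so the bounds hold for any matrix. *)
Lemma overlap_loss_bounds A z : 0 <= overlap_loss A z <= 1.
Proof.
rewrite sqrtr_ge0/= -[leRHS]sqrtr1 ler_sqrt// lerBlDr lerDl.
by rewrite -ler_toC toC_Re ?exprn_ge0.
Qed.

Lemma measurable_overlap_loss A : measurable_fun setT (overlap_loss A).
Proof.
pose rho x := psi x *m (psi x)^t*.
have m1 i j :
    cmeasurable (fun z : pure_state R n * pure_state R n => rho z.1 i j).
  exact: (cmeasurable_comp (cmeasurable_projector i j) measurable_fst).
have m2 i j :
    cmeasurable (fun z : pure_state R n * pure_state R n => rho z.2 i j).
  exact: (cmeasurable_comp (cmeasurable_projector i j) measurable_snd).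
have mc (B : 'M[C]_(qdim n)) i j :
    cmeasurable (fun z : pure_state R n * pure_state R n => B i j).
  exact: cmeasurable_cst.
(* The squared overlap is a trace involving the two projectors, hence a polynomial in their
   measurable entries. *)
have E z : `|inner (psi z.2) (A *m psi z.1)| ^+ 2 =
    \sum_i (rho z.2 *m (A *m rho z.1 *m A^t*)) i i :> C.
  rewrite -mxtrace_projectors; congr (\tr (_ *m _)).
  by rewrite adjmx_mul !mulmxA.
have [mE _] : cmeasurable (fun z => `|inner (psi z.2) (A *m psi z.1)| ^+ 2 : C).
  rewrite (funext E); apply: cmeasurable_sum => i.
  exact: (cmeasurable_mulmx m2
    (cmeasurable_mulmx (cmeasurable_mulmx (mc A) m1) (mc (A^t*))) i i).
exact: (measurableT_comp (continuous_measurable_fun (@sqrt_continuous R))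
  (measurable_funB (measurable_cst (1 : R)) mE)).
Qed.

(** By Cauchy-Schwarz against the unit vector [psi z.2], the modulus of the overlap moves by at most
    [e]. Isometry of both matrices keeps these moduli in [[0, 1]], where the square-root estimate
    applies. *)
Lemma overlap_loss_near A B e z : near_iso (toC e) A B ->
  `|overlap_loss A z - overlap_loss B z| <= Num.sqrt (2 * e).
Proof.
move=> [AA BB AB]; set x := psi z.1; set y := psi z.2.
pose ov (D : 'M[C]_(qdim n)) : R := complex.Re (`|inner y (D *m x)|).
have ovE D : `|inner y (D *m x)| = toC (ov D) :> C by rewrite toC_Re.
have ov0 D : 0 <= ov D by rewrite -ler_toC -ovE toC0 normr_ge0.
have ov1 D : isometry_mx D -> ov D <= 1.
  move=> DD; rewrite -ler_toC -ovE (le_trans (inner_vnorm _ _))//.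
  by rewrite vnorm_isometry// !vnorm_psi mulr1.
have lossE D : overlap_loss D z = Num.sqrt (1 - ov D ^+ 2).
  by rewrite /overlap_loss -/x -/y ovE -toCX.
have abe : `|ov A - ov B| <= e.
  rewrite -ler_toC -toC_norm toCD toCN -!ovE (le_trans (ler_dist_dist _ _))//.
  rewrite -innerBr (le_trans (inner_vnorm _ _))// vnorm_psi mul1r.
  by rewrite (le_trans (AB _))// vnorm_psi mulr1.
rewrite !lossE; apply: ler_dist_sqrt_1Bsqr => //.
  by apply/andP; split; [exact: ov0|exact: ov1].
by apply/andP; split; [exact: ov0|exact: ov1].
Qed.

End pure_state_theory.

(** * Concentration and empirical risk minimization *)

Section concentration.
Context {R : realType} d {T : measurableType d}.
Implicit Types (P : probability T R) (g : T -> R).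

(** [expR (- x) >= 1 - x] gives [expR x * (1 - x) <= 1], while [(1 + x + 2 x^2) (1 - x) = 1 + x^2 (1
    - 2 x) >= 1]. The generous coefficient [2] keeps the argument algebraic. *)
Lemma expR_le_quadratic (x : R) : x <= 1 / 2 -> expR x <= 1 + x + 2 * x ^+ 2.
Proof.
move=> x2; have := expR_ge1Dx (- x); rewrite expRN => h.
have e0 : 0 < expR x by exact: expR_gt0.
have h1 : expR x * (1 - x) <= 1.
  have : expR x * (1 - x) <= expR x * (expR x)^-1 by rewrite ler_pM2l.
  by rewrite mulfV ?gt_eqF.
have h2 : 1 <= (1 + x + 2 * x ^+ 2) * (1 - x).
  have -> : (1 + x + 2 * x ^+ 2) * (1 - x) = 1 + x ^+ 2 * (1 - 2 * x) by ring.
  by rewrite lerDl mulr_ge0 ?sqr_ge0//; lra.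
rewrite -(@ler_pM2r _ (1 - x)); last by lra.
exact: le_trans h1 h2.
Qed.

Lemma bounded_integrable P g (M : R) : measurable_fun setT g ->
  (forall x, `|g x| <= M) -> P.-integrable setT (EFin \o g).
Proof.
move=> mg gM; apply: measurable_bounded_integrable => //.
  by rewrite (le_lt_trans (probability_le1 _ _)) ?ltry.
exists M; split; first exact: num_real.
by move=> x Mx y _ /=; rewrite (le_trans (gM y))// ltW.
Qed.

(** The quadratic bound on the exponential is integrated: the linear term has mean zero, and
    [1 + 2 l^2 <= expR (2 l^2)]. The range of [l] keeps [l * g x] where that bound holds. *)
Lemma mgf_le P g (l : R) : measurable_fun setT g -> (forall x, `|g x| <= 1) ->
  \int[P]_x g x = 0 -> 0 <= l <= 1 / 2 ->
  (\int[P]_x (expR (l * g x))%:E <= (expR (2 * l ^+ 2))%:E)%E.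
Proof.
move=> mg g1 g0 /andP[l0 l2].
have lg1 x : `|l * g x| <= 1 / 2.
  by rewrite normrM ger0_norm// -[leRHS]mulr1 ler_pM.
have ig := bounded_integrable P mg g1.
have ige : (\int[P]_x (g x)%:E = 0)%E.
  rewrite -[LHS]fineK; last exact: integrable_fin_num.
  by move: g0; rewrite /Rintegral => ->.
pose k := 1 + 2 * l ^+ 2.
have mlg : measurable_fun setT (fun x => l * g x) by exact: measurable_funM.
apply: (@le_trans _ _ (\int[P]_x (k%:E + l%:E * (g x)%:E))%E).
  apply: ge0_le_integral => //.
  - by apply/measurable_EFinP; exact: measurableT_comp.
  - apply/measurable_EFinP; apply: measurable_funD => //.
  - move=> x _; rewrite -EFinM -EFinD lee_fin.
    rewrite (le_trans (expR_le_quadratic _))//.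
      exact: le_trans (ler_norm _) (lg1 x).
    rewrite /k [leRHS]addrAC lerD2l ler_pM2l// exprMn -[leRHS]mulr1.
    rewrite ler_wpM2l ?sqr_ge0// -real_normK ?num_real//.
    by rewrite exprn_ile1.
rewrite integralD//=; last 2 first.
- exact: (finite_measure_integrable_cst P k).
- exact: (integrableZl measurableT l ig).
rewrite integral_cst//= probability_setT mule1 integralZl// ige mule0 adde0.
by rewrite lee_fin expR_ge1Dx.
Qed.

Lemma measurable_sum_tnth m g : measurable_fun setT g ->
  measurable_fun setT (fun S : m.-tuple T => \sum_(i < m) g (tnth S i)).
Proof.
move=> mg; apply: measurable_sum => i.
exact: (measurableT_comp mg (measurable_tnth i)).
Qed.

(** Induction on [m]: [iid P m.+1] is an image of the product of [P] and [iid P m], and Tonelli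
    splits the exponential of the sum. The Dirac mass at the empty tuple gives [1]. *)
Lemma iid_mgf P g (l : R) m : measurable_fun setT g ->
  (\int[iid P m]_S (expR (l * \sum_(i < m) g (tnth S i)))%:E =
   (\int[P]_x (expR (l * g x))%:E) ^+ m)%E.
Proof.
move=> mg; have mE k : measurable_fun setT
    (fun S : k.-tuple T => (expR (l * \sum_(i < k) g (tnth S i)))%:E).
  apply/measurable_EFinP; apply: (measurableT_comp (@measurable_expR R)).
  by apply: measurable_funM => //; exact: measurable_sum_tnth.
have mG : measurable_fun setT (fun x => (expR (l * g x))%:E).
  apply/measurable_EFinP; apply: (measurableT_comp (@measurable_expR R)).
  exact: measurable_funM.
elim: m => [|m ih].
  rewrite /= integral_dirac//; last exact: (mE 0).
  by rewrite diracE in_setT mul1e big_ord0 mulr0 expR0.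
transitivity (\int[(P \x iid P m)%E]_z
    ((expR (l * g z.1))%:E * (expR (l * \sum_(i < m) g (tnth z.2 i)))%:E)%E)%E.
  have eR S : (0 <= (expR (l * \sum_(i < m.+1) g (tnth S i)))%:E)%E.
    by rewrite lee_fin expR_ge0.
  apply: etrans (@ge0_integral_distribution _ _ _ _ R (P \x iid P m)%E
    (@sample_cons _ _ m) _ (mE m.+1) eR) _.
  apply: eq_integral => -[x S] _ /=.
  rewrite big_ord_recl tnth0 mulrDr expRD EFinM.
  congr (_ * (expR (_ * _))%:E)%E.
  by apply: eq_bigr => i _; rewrite tnthS.
rewrite expeS -ih fubini_tonelli1; last 2 first.
- apply: emeasurable_funM; first exact: (measurableT_comp mG).
  exact: (measurableT_comp (mE m)).
- by move=> z; rewrite -EFinM lee_fin mulr_ge0 ?expR_ge0.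
rewrite /fubini_F/=.
under eq_integral => x _.
  rewrite ge0_integralZl//; last exact: mE.
  over.
by rewrite /= ge0_integralZr//; apply: integral_ge0.
Qed.

Lemma chernoff_iid P g (t : R) m : measurable_fun setT g ->
  (forall x, `|g x| <= 1) -> \int[P]_x g x = 0 -> 0 < t <= 1 ->
  (iid P m [set S | m%:R * t <= \sum_(i < m) g (tnth S i)]%R
   <= (expR (- (m%:R * t ^+ 2 / 8)))%:E)%E.
Proof.
(* [l = t / 4] minimizes [2 l^2 - l t], with value [- t^2 / 8]; [t <= 1] keeps [l] below [1 / 2]. *)
move=> mg g1 g0 /andP[t0 t1]; pose l := t / 4.
have l0 : 0 < l by rewrite divr_gt0.
have mX := @measurable_sum_tnth m g mg.
pose X : {mfun _ >-> _} := HB.pack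
  (fun S : m.-tuple T => \sum_(i < m) g (tnth S i))
  (isMeasurableFun.Build _ _ _ _ _ mX).
have := @chernoff _ _ _ (iid P m) X l (m%:R * t) l0.
move=> /le_trans; apply.
rewrite /mmt_gen_fun unlock.
rewrite [X in (X * _)%E](_ : _ =
    \int[iid P m]_S (expR (l * \sum_(i < m) g (tnth S i)))%:E)%E; last first.
  by apply: eq_integral => S _ /=; rewrite mulrC.
rewrite iid_mgf//.
have l12 : 0 <= l <= 1 / 2 by apply/andP; split; rewrite ?ltW// /l; lra.
have := mgf_le mg g1 g0 l12.
set I := (\int[P]_x _)%E => I_le.
have I0 : (0 <= I)%E by apply: integral_ge0 => x _; rewrite lee_fin expR_ge0.
have Im : (I ^+ m <= (expR (m%:R * (2 * l ^+ 2)))%:E)%E.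
  rewrite expRM_natl EFin_expe.
  elim: m {X mX} => [|m ih]; first by rewrite !expe0.
  by rewrite !expeS lee_pmul// expe_ge0.
apply: (@le_trans _ _ ((expR (m%:R * (2 * l ^+ 2)))%:E *
    (expR (- (l * (m%:R * t))))%:E)%E).
  by rewrite lee_wpmul2r// lee_fin expR_ge0.
rewrite -EFinM lee_fin -expRD ler_expR /l le_eqVlt; apply/orP; left.
by apply/eqP; field.
Qed.

(** The window of width one may start anywhere: [a = 0] serves a loss and [a = -1] its negative, so
    one upper tail yields both directions. The mean lies in the same window, so the centered
    function is bounded by [1]. *)
Lemma hoeffding_iid P g (a t : R) m : measurable_fun setT g ->
  (forall x, a <= g x <= a + 1) -> 0 < t <= 1 -> (0 < m)%N ->
  let A := [set S : m.-tuple T |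
    t <= m%:R^-1 * (\sum_(i < m) g (tnth S i)) - \int[P]_x g x] in
  measurable A /\ (iid P m A <= (expR (- (m%:R * t ^+ 2 / 8)))%:E)%E.
Proof.
move=> mg ga t01 m0 A; set mu := \int[P]_x g x in A *.
have m0' : 0 < m%:R :> R by rewrite ltr0n.
have ig : P.-integrable setT (EFin \o g).
  apply: (@bounded_integrable _ _ (`|a| + 1)) => // x; have /andP[l u] := ga x.
  rewrite ler_norml; apply/andP; split.
    by have := ler_norm (- a); rewrite normrN; lra.
  by have := ler_norm a; lra.
have ic k : P.-integrable setT (EFin \o cst k).
  exact: finite_measure_integrable_cst.
have intc k : \int[P]_x (cst k x) = k.
  by rewrite Rintegral_cst//= probability_setT mulr1.
have mua : a <= mu <= a + 1.
  apply/andP; split.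
    rewrite -(intc a); apply: le_Rintegral => // x _.
    by have /andP[] := ga x.
  rewrite -(intc (a + 1)); apply: le_Rintegral => // x _.
  by have /andP[] := ga x.
pose h x := g x - mu.
have mh : measurable_fun setT h by exact: measurable_funB.
have h1 x : `|h x| <= 1.
  have /andP[l u] := ga x; have /andP[l' u'] := mua.
  by rewrite /h ler_norml; apply/andP; split; lra.
have h0 : \int[P]_x h x = 0.
  by rewrite (@RintegralB _ _ _ _ _ _ (cst mu))// intc subrr.
have AE : A = [set S | m%:R * t <= \sum_(i < m) h (tnth S i)].
  apply/funext => S; rewrite /A/= sumrB sumr_const card_ord -(mulr_natl mu).
  by rewrite -(ler_pM2l m0') mulrBr mulVKf// gt_eqF.
split; last by rewrite AE; exact: chernoff_iid.
rewrite AE -[X in measurable X]setTI.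
rewrite (_ : [set S | _] =
    (fun S : m.-tuple T => \sum_(i < m) h (tnth S i))
      @^-1` `[m%:R * t, +oo[%classic).
  exact: measurable_sum_tnth.
by apply/seteqP; split => S /=; rewrite in_itv/= andbT.
Qed.

Lemma measure_bigsetU_le (mu : {measure set T -> \bar R}) (I : Type) (s : seq I)
    (A : I -> set T) (e : R) : (forall i, measurable (A i)) ->
  (forall i, (mu (A i) <= e%:E)%E) ->
  (mu (\big[setU/set0]_(i <- s) A i) <= ((size s)%:R * e)%:E)%E.
Proof.
move=> mA Ae; elim: s => [|i s ih]; first by rewrite big_nil measure0 mul0r.
rewrite big_cons/= (le_trans (measureU2 _ _ _))//.
  exact: bigsetU_measurable.
by rewrite mulrSr mulrDl mul1r (addrC _ e) EFinD; apply: leeD; first exact: Ae.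
Qed.

End concentration.

(** * Empirical risk minimization over a finitely covered class *)

Section empirical_risk_minimization.
Context {R : realType} {dX dY : measure_display}.
Context {X : measurableType dX} {Y : measurableType dY}.
Variable loss : Y -> Y -> R.
Variable P : probability (X * Y)%type R.
Local Notation floss f := (fun z : X * Y => loss z.2 (f z.1)).

(** Let [g i] approximate the loss of [hhat]. Off the exceptional event, the risk of [hhat] is at
    most the mean of [g i] plus [eta], hence below its empirical mean plus [t + eta], hence below
    the empirical risk of [hhat] plus [t + 2 eta]. Minimality passes to [h], whose own deviation
    costs the second [t]. One one-sided deviation for each [g i] and one for [h] make [#|I|.+1]
    events. *)
Lemma erm_finite_cover (F : set (X -> Y)) (I : finType) (g : I -> X * Y -> R)
    (eta t : R) m h :
  (forall i, measurable_fun setT (g i)) -> (forall i z, 0 <= g i z <= 1) ->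
  (forall f, F f -> measurable_fun setT (floss f)) ->
  (forall f, F f -> forall z, 0 <= loss z.2 (f z.1) <= 1) ->
  (forall f, F f -> exists i, forall z, `|loss z.2 (f z.1) - g i z| <= eta) ->
  0 < t <= 1 -> (0 < m)%N -> argmin F (risk loss P) h ->
  prob_ge (iid P m)
    [set S | forall hhat, argmin F (empirical_risk loss S) hhat ->
       risk loss P hhat - risk loss P h <= 2 * t + 2 * eta]
    (1 - #|I|.+1%:R * expR (- (m%:R * t ^+ 2 / 8))).
Proof.
move=> mg g01 mF F01 cover t01 m0 [Fh h_min].
set e := expR _.
pose emp (phi : X * Y -> R) (S : m.-tuple (X * Y)) :=
  m%:R^-1 * (\sum_(k < m) phi (tnth S k)).
pose Bh := [set S : m.-tuple (X * Y) |
  t <= emp (floss h) S - \int[P]_z floss h z].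
pose Bg i := [set S : m.-tuple (X * Y) |
  t <= emp (fun z => - g i z) S - \int[P]_z (- g i z)].
have [mBh PBh] : measurable Bh /\ (iid P m Bh <= e%:E)%E.
  apply: (@hoeffding_iid _ _ _ P _ 0) => // [|z]; first exact: mF.
  by rewrite add0r; exact: F01.
have BgP i : measurable (Bg i) /\ (iid P m (Bg i) <= e%:E)%E.
  apply: (@hoeffding_iid _ _ _ P _ (-1)) => //; first exact: measurable_funN.
  by move=> z; have /andP[l u] := g01 i z; apply/andP; split; lra.
pose B := Bh `|` \big[setU/set0]_(i <- enum I) Bg i.
have mBg : measurable (\big[setU/set0]_(i <- enum I) Bg i).
  by apply: bigsetU_measurable => i _; have [] := BgP i.
have mB : measurable B by exact: measurableU.
exists (~` B); split; first exact: measurableC.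
- move=> S nB hhat [Fhh hh_min].
  have nBh : emp (floss h) S - \int[P]_z floss h z < t.
    by rewrite ltNge; apply/negP => Sh; apply: nB; left.
  have [i hi] := cover _ Fhh.
  have nBg : emp (fun z => - g i z) S - \int[P]_z (- g i z) < t.
    rewrite ltNge; apply/negP => Si; apply: nB; right.
    rewrite (bigD1_seq i) ?mem_enum ?enum_uniq//=; by left.
  have emp_min : emp (floss hhat) S <= emp (floss h) S by exact: hh_min.
  have M1 : forall z, `|g i z| <= 1.
    by move=> z; have /andP[l u] := g01 i z; rewrite ger0_norm.
  have ig : P.-integrable setT (EFin \o g i) by exact: bounded_integrable.
  have ih : P.-integrable setT (EFin \o floss hhat).
    apply: (@bounded_integrable _ _ _ _ _ 1); first exact: mF.
    by move=> z; have /andP[l u] := F01 _ Fhh z; rewrite ger0_norm.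
  have ie : P.-integrable setT (EFin \o cst eta).
    exact: finite_measure_integrable_cst.
  have risk_le : risk loss P hhat <= \int[P]_z g i z + eta.
    have <- : \int[P]_z (g i z + cst eta z) = \int[P]_z g i z + eta.
      by rewrite RintegralD// Rintegral_cst//= probability_setT mulr1.
    apply: le_Rintegral => //.
      rewrite (_ : _ \o _ = (EFin \o g i) \+ (EFin \o cst eta))%E.
        exact: integrableD.
      by apply/funext => z /=; rewrite EFinD.
    by move=> z _ /=; have := hi z; rewrite ler_norml => /andP[_]; lra.
  have emp_le : emp (g i) S <= emp (floss hhat) S + eta.
    have m0' : 0 < m%:R :> R by rewrite ltr0n.
    have -> : emp (floss hhat) S + eta = emp (fun z => floss hhat z + eta) S.
      rewrite /emp big_split/= sumr_const card_ord mulrDr -(mulr_natl eta).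
      by rewrite mulKf// gt_eqF.
    rewrite /emp ler_pM2l ?invr_gt0//; apply: ler_sum => k _.
    by have := hi (tnth S k); rewrite ler_norml => /andP[+ _]; lra.
  have empN : emp (fun z => - g i z) S = - emp (g i) S.
    by rewrite /emp sumrN mulrN.
  have intN : \int[P]_z (- g i z) = - \int[P]_z g i z.
    under eq_Rintegral do rewrite -mulN1r.
    by rewrite RintegralZl// mulN1r.
  move: nBg nBh; rewrite empN intN {2}/risk; move: risk_le emp_le emp_min.
  lra.
- rewrite probability_setC// EFinB leeB//.
  rewrite /B (le_trans (measureU2 _ _ _))//.
  rewrite mulrS mulrDl mul1r EFinD leeD// cardE.
  by apply: measure_bigsetU_le => i; have [] := BgP i.
Qed.

End empirical_risk_minimization.

(** * Covering the hypothesis space *)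

Section parameter_grid.
Context {R : realType}.
Variables (n d G : nat).

(** Level [j] stands for the angle [j * grid_step]. *)
Definition grid := {ffun 'I_d * 'I_n * 'I_4 * 'I_3 -> 'I_G.+1}.

Definition grid_step : R := 2 * pi / G.+1%:R.

Definition grid_params (k : grid) (l i : nat) (a : 'I_4) (b : 'I_3) : R :=
  match insub l : option 'I_d, insub i : option 'I_n with
  | Some l', Some i' => (k (l', i', a, b))%:R * grid_step
  | _, _ => 0
  end.

Lemma card_grid : #|{: grid}| = (G.+1 ^ (d * n * 12))%N.
Proof. by rewrite card_ffun !card_prod !card_ord -mulnA. Qed.

Lemma grid_step_gt0 : 0 < grid_step.
Proof. by rewrite divr_gt0 ?ltr0n// mulr_gt0// pi_gt0. Qed.

(** Each angle is rounded down to a multiple of the step. As angles are strictly below [2 * pi], the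
    quotient is below [G.+1] and its integer part is a valid level. *)
Lemma grid_dense (t : nat -> nat -> 'I_4 -> 'I_3 -> R) :
  (forall l i a b, 0 <= t l i a b < 2 * pi) ->
  exists k : grid, forall l i a b, (l < d)%N -> (i < n)%N ->
    `|t l i a b - grid_params k l i a b| <= grid_step.
Proof.
move=> t02.
exists [ffun x : 'I_d * 'I_n * 'I_4 * 'I_3 =>
  inord (Num.trunc (t x.1.1.1 x.1.1.2 x.1.2 x.2 / grid_step))].
move=> l i a b ld id; rewrite /grid_params (@insubT _ (ltn^~ d) _ l ld).
rewrite (@insubT _ (ltn^~ n) _ i id) ffunE/=.
have /andP[t0 t2] := t02 l i a b; have s0 := grid_step_gt0.
set q := _ / grid_step.
have q0 : 0 <= q by rewrite divr_ge0// ltW.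
have qG : q < G.+1%:R.
  by rewrite ltr_pdivrMr// /grid_step mulrC divfK ?pnatr_eq0.
have /andP[ql qu] := truncn_itv q0.
rewrite inordK; last by rewrite -(ltr_nat R); exact: le_lt_trans qG.
have tq : t l i a b = q * grid_step by rewrite divfK// gt_eqF.
rewrite tq -mulrBl normrM (gtr0_norm s0) ler_piMl ?ltW//.
rewrite ger0_norm ?subr_ge0//.
by move: qu; rewrite -natr1; lra.
Qed.

Lemma hypotheses_grid_cover (f : pure_state R n -> pure_state R n) :
  hypotheses R n d f -> exists k : grid, forall z,
    `|trace_dist R n z.2 (f z.1) -
      overlap_loss (circuit n d (grid_params k)) z|
    <= Num.sqrt (2 * (grid_step *+ (12 * n.-1 * d))).
Proof.
move=> [t t02 ft]; have [k tk] := grid_dense t02; exists k => -[x y] /=.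
rewrite (trace_dist_phase y (ft x)); apply: overlap_loss_near.
have := @circuit_near R n d t (grid_params k) grid_step.
rewrite (_ : toC grid_step *+ _ = toC (grid_step *+ (12 * n.-1 * d))).
  by apply=> l i a b ld id; exact: tk.
by rewrite -mulr_natr -(mulr_natr grid_step) toCM toC_nat.
Qed.

Lemma hypotheses_loss (f : pure_state R n -> pure_state R n) :
  hypotheses R n d f ->
  measurable_fun setT
    (fun z : pure_state R n * pure_state R n => trace_dist R n z.2 (f z.1)) /\
  forall z : pure_state R n * pure_state R n,
    0 <= trace_dist R n z.2 (f z.1) <= 1.
Proof.
move=> [t _ ft].
have E : (fun z : pure_state R n * pure_state R n => trace_dist R n z.2 (f z.1))
    = overlap_loss (circuit n d t).
  by apply/funext => -[x y]; exact: trace_dist_phase.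
split; first by rewrite E; exact: measurable_overlap_loss.
by move=> z; have /(congr1 (@^~ z)) /= -> := E; exact: overlap_loss_bounds.
Qed.

End parameter_grid.

(** * Arithmetic of the sample size *)

Section sample_complexity.
Context {R : realType}.

(* [1024] makes the covering error at most [eps / 8]; in [sample_size], [128] is
   [8 / t ^+ 2] for the deviation [t = eps / 4], up to [eps ^+ 2]. *)
Definition grid_size (p : nat) (eps : R) : nat :=
  Num.trunc (1024 * p%:R / eps ^+ 2).

Definition sample_size (p : nat) (eps delta : R) : nat :=
  (Num.trunc (128 / eps ^+ 2 *
    (ln 2 + p%:R * ln (grid_size p eps).+1%:R + ln (1 / delta)))).+1.

(** After squaring, the quantity under the root must be at most [eps^2 / 64]. With [pi <= 4] and
    [12 (n - 1) d <= p] it is at most [16 p / (G + 1)], and [16 * 64 = 1024]. *)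
Lemma grid_error_le n d (eps : R) : 0 < eps < 1 ->
  Num.sqrt (2 * (@grid_step R (grid_size (d * n * 12) eps) *+ (12 * n.-1 * d)))
    <= eps / 8.
Proof.
move=> /andP[e0 e1]; set p := (d * n * 12)%N; set G := grid_size p eps.
rewrite -[leRHS]ger0_norm ?divr_ge0 ?(ltW e0)// -sqrtr_sqr ler_wsqrtr//.
have G0 : 0 < G.+1%:R :> R by rewrite ltr0n.
have p_le : (12 * n.-1 * d)%:R <= p%:R :> R.
  have -> : (12 * n.-1 * d = d * n.-1 * 12)%N by ring.
  by rewrite ler_nat /p !(leq_mul2r, leq_mul2l) leq_pred !orbT.
have GE : 1024 * p%:R <= G.+1%:R * eps ^+ 2.
  by rewrite -ler_pdivrMr ?exprn_gt0// ltW// truncnS_gt.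
have pi4 : pi <= 4 :> R.
  by have /andP[_] := (pihalf_02_cos_pihalf R).1; lra.
have pi0 := pi_gt0 R.
rewrite /grid_step -(mulr_natr (2 * pi / G.+1%:R)).
have -> : 2 * (2 * (pi : R) / G.+1%:R * (12 * n.-1 * d)%:R) =
  4 * (pi : R) * (12 * n.-1 * d)%:R / G.+1%:R by ring.
rewrite ler_pdivrMr// exprMn.
have : 4 * (pi : R) * (12 * n.-1 * d)%:R <= 16 * p%:R.
  by apply: ler_pM => //; rewrite ?mulr_ge0//; lra.
have -> : 8^-1 ^+ 2 = 64^-1 :> R by rewrite exprVn; congr (_^-1); ring.
move: GE; lra.
Qed.

(** With [G] levels per parameter, the number of events is
    [G^p + 1 <= 2 G^p = expR (ln 2 + p ln G)]. The exponent [m (eps / 4)^2 / 8 = m eps^2 / 128]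
    exceeds [ln 2 + p ln G + ln (1 / delta)] by the choice of [sample_size]. *)
Lemma failure_prob_le p m (eps delta : R) : 0 < eps < 1 -> 0 < delta < 1 ->
  (sample_size p eps delta <= m)%N ->
  ((grid_size p eps).+1 ^ p).+1%:R * expR (- (m%:R * (eps / 4) ^+ 2 / 8))
    <= delta.
Proof.
move=> /andP[e0 e1] /andP[d0 d1] mge; set G := (grid_size p eps).+1 in mge *.
have G0 : 0 < G%:R :> R by rewrite ltr0n.
pose E : R := ln 2 + p%:R * ln G%:R + ln (1 / delta).
have mE : E <= m%:R * eps ^+ 2 / 128.
  have : 128 / eps ^+ 2 * E <= m%:R.
    by rewrite (le_trans (ltW (truncnS_gt _)))// ler_nat.
  by rewrite mulrAC ler_pdivrMr ?exprn_gt0//; lra.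
have N_le : ((G ^ p).+1%:R : R) <= expR (ln 2 + p%:R * ln G%:R).
  rewrite expRD lnK ?posrE// expRM_natl lnK ?posrE//.
  have : 1 <= (G ^ p)%:R :> R by rewrite ler1n expn_gt0.
  by rewrite natrX -natr1 natrX; lra.
rewrite (le_trans (ler_wpM2r (expR_ge0 _) N_le))// -expRD.
rewrite -[leRHS]lnK ?posrE// ler_expR.
have lnd : ln (1 / delta) = - ln delta by rewrite ln_div ?posrE// ln1 sub0r.
move: mE; rewrite /E lnd exprMn.
have -> : (4^-1) ^+ 2 = 16^-1 :> R by rewrite exprVn; congr (_^-1); ring.
lra.
Qed.

Lemma sample_size_le (c M : R) : 0 <= c -> 0 < M ->
  exists K : R, forall (n : nat) (eps delta : R),
    (2 <= n)%N -> 0 < eps < 1 -> 0 < delta < 1 ->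
    (sample_size (`|Num.ceil (M * n%:R `^ c)|%N * n * 12) eps delta)%:R <=
      K * (1 / eps ^+ 2 *
           (n%:R `^ (c + 1) * ln (n%:R / eps) + ln (1 / delta))).
Proof.
move=> c0 M0.
pose l2 : R := ln 2; have l20 : 0 < l2 by rewrite ln_gt0// ltr1n.
(* From [p = 12 D n] and [D <= (M + 1) n^c] comes [p <= q n^(c + 1)]. In [Q], [1025 = 1024 + 1]
   absorbs the successor in the number of levels. *)
pose q : R := 12 * (M + 1); pose Q : R := 1025 * q.
have q1 : 1 <= q by rewrite /q; lra.
have QE : Q = 1025 * q by [].
have Q1 : 1 <= Q by lra.
have Q0 : 0 < Q by exact: lt_le_trans Q1.
clearbody Q.
have lnQ : 0 <= ln Q by exact: ln_ge0.
(* From [ln G.+1 <= ln Q + (c + 1) ln n + 2 ln (1 / eps)]: with [L = ln (n / eps) >= l2], the first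
   term is at most [(ln Q / l2) L], and the others at most [(c + 1) L] and [2 L]. *)
pose c1 : R := ln Q / l2 + c + 3.
have c10 : 0 <= c1 by rewrite /c1 !addr_ge0// divr_ge0// ltW.
(* After multiplication by [eps^2], the four summands pay in turn for the successor in
   [sample_size], for [128 * ln 2], for [128] times the covering term, and for
   [128 * ln (1 / delta)]. *)
exists (l2^-1 + 128 + 128 * (q * c1) + 128) => n eps delta n2.
move=> /andP[e0 e1] /andP[d0 d1].
have n1 : 1 <= n%:R :> R by rewrite ler1n (leq_trans _ n2).
have n0 : 0 < n%:R :> R by exact: lt_le_trans n1.
set D := `|_|%N; set p := (D * n * 12)%N.
set A := n%:R `^ (c + 1); set L := ln (n%:R / eps); set W := ln (1 / delta).
have powR1 (x : R) : 0 <= x -> 1 <= n%:R `^ x :> R.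
  by move=> x0; rewrite -[leLHS](powRr0 (n%:R : R)) ler_powR.
have nc1 := powR1 c c0.
have A1 : 1 <= A by apply: powR1; rewrite addr_ge0.
have AE : A = n%:R `^ c * n%:R.
  by rewrite /A powRD ?powRr1 ?ltW// (gt_eqF n0) implybT.
have D_le : D%:R <= (M + 1) * n%:R `^ c.
  have x0 : 0 <= M * n%:R `^ c by rewrite mulr_ge0 ?powR_ge0 ?ltW.
  have : D%:R < M * n%:R `^ c + 1.
    rewrite /D natr_absz ger0_norm; last first.
      by rewrite ceil_ge0// (lt_le_trans _ x0).
    by rewrite -ltrBlDr; have := gt_pred_ceil (M * n%:R `^ c); rewrite intrB.
  by rewrite mulrDl mul1r => /ltW/le_trans; apply; rewrite lerD2l.
have p_le : p%:R <= q * A.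
  rewrite /p !natrM AE /q; move: D_le; rewrite -(ler_pM2r n0).
  by move: (D%:R) (n%:R `^ c); clear; move=> x y; lra.
have p0 : 0 <= p%:R :> R by rewrite ler0n.
move: p p_le p0; clear AE D_le nc1 powR1 D => p p_le p0.
have ie1 : 1 <= 1 / eps by rewrite ler_pdivlMr// mul1r ltW.
have lnn : l2 <= ln n%:R by rewrite ler_ln ?posrE// ler_nat.
have LE : L = ln n%:R + ln (1 / eps).
  by rewrite /L -lnM ?posrE ?divr_gt0// mul1r.
have lne0 : 0 <= ln (1 / eps) by exact: ln_ge0.
have L2 : l2 <= L by rewrite LE; lra.
have W0 : 0 <= W by rewrite ln_ge0// ler_pdivlMr// mul1r ltW.
have trunc_le (x : R) : 0 <= x -> (Num.trunc x)%:R <= x.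
  by move=> x0; have /andP[] := truncn_itv x0.
have e20 : 0 < eps ^+ 2 by exact: exprn_gt0.
have i2 : 1 <= (1 / eps) ^+ 2 by rewrite exprn_ege1.
have X0 : 0 <= 1024 * p%:R / eps ^+ 2.
  by apply: divr_ge0; [apply: mulr_ge0; exact: ler0n|exact: ltW].
have G_le : (grid_size p eps)%:R <= 1024 * p%:R / eps ^+ 2 := trunc_le _ X0.
rewrite /sample_size; move: (grid_size p eps) G_le => G G_le0.
have G_le : G.+1%:R <= Q * A * (1 / eps) ^+ 2.
  have X_le : 1024 * p%:R / eps ^+ 2 <= 1024 * (q * A) * (1 / eps) ^+ 2.
    rewrite expr_div_n expr1n mul1r; apply: ler_wpM2r.
      by rewrite invr_ge0 ltW.
    by apply: ler_wpM2l; [exact: ler0n|exact: p_le].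
  have qA1 : 1 <= q * A * (1 / eps) ^+ 2 by do 2 apply: mulr_ege1 => //.
  rewrite -natr1 QE; move: G_le0 X_le qA1; clear.
  move: (_ / _ ^+ 2) ((1 / eps) ^+ 2) (G%:R) => x y g.
  by rewrite -!mulrA; move: (q * (A * y)) => w; lra.
have lnG : ln G.+1%:R <= c1 * L.
  have A0 : 0 < A by exact: lt_le_trans A1.
  have i0 : 0 < 1 / eps by exact: lt_le_trans ie1.
  have y0 : 0 < (1 / eps) ^+ 2 by exact: exprn_gt0.
  have QA0 : 0 < Q * A by exact: mulr_gt0.
  apply: (@le_trans _ _ (ln (Q * A * (1 / eps) ^+ 2))).
    by rewrite ler_ln ?posrE ?ltr0n//; exact: mulr_gt0.
  rewrite (lnM (x := Q * A)) ?posrE// lnM ?posrE// lnXn// ln_powR.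
  have h1 : ln Q <= ln Q / l2 * L.
    by rewrite mulrAC ler_pdivlMr// ler_wpM2l.
  have h2 : (c + 1) * ln n%:R <= (c + 1) * L.
    by rewrite ler_wpM2l ?addr_ge0// LE lerDl.
  have h3 : ln (1 / eps) <= L by rewrite LE lerDr (le_trans (ltW l20)).
  by rewrite mulr2n /c1; lra.
have lnG0 : 0 <= ln G.+1%:R :> R by rewrite ln_ge0 ?ler1n.
pose Z := A * L + W.
(* [n >= 2] keeps [Z] away from zero, so that constants are absorbed as multiples of [Z]. *)
have Zl2 : l2 <= Z.
  have : l2 <= A * L by rewrite -[leLHS]mul1r ler_pM// ltW.
  by rewrite /Z; lra.
have pG : p%:R * ln G.+1%:R <= q * c1 * Z.
  apply: (@le_trans _ _ (q * A * (c1 * L))); first by rewrite ler_pM.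
  rewrite mulrACA; apply: ler_wpM2l.
    by apply: mulr_ge0 => //; exact: le_trans ler01 q1.
  by rewrite /Z lerDl.
have one_le : 1 <= l2^-1 * Z by rewrite mulrC ler_pdivlMr// mul1r.
have e21 : eps ^+ 2 <= 1 by rewrite exprn_ile1 ?ltW.
rewrite -/Z; set K := _ + 128.
have -> : K * (1 / eps ^+ 2 * Z) = K * Z / eps ^+ 2.
  by rewrite div1r [RHS]mulrC mulrCA.
rewrite ler_pdivlMr// /K.
rewrite -/W -/l2 -natr1 mulrDl mul1r.
set E := l2 + _ + W.
have E0 : 0 <= E.
  by rewrite addr_ge0// addr_ge0 ?(ltW l20)//; exact: mulr_ge0.
have E_le : (Num.trunc (128 / eps ^+ 2 * E))%:R * eps ^+ 2 <= 128 * E.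
  rewrite -ler_pdivlMr// mulrAC; apply: trunc_le.
  apply: divr_ge0; last exact: ltW.
  by apply: mulr_ge0; [exact: ler0n|].
have WZ : W <= Z.
  by rewrite /Z lerDr mulr_ge0 ?(le_trans ler01 A1) ?(le_trans (ltW l20) L2).
move: E_le pG one_le e21 Zl2 WZ; rewrite /E; clear.
move: (eps ^+ 2) (p%:R * ln _) (q * c1) (_ * eps ^+ 2) => y u v x.
move: (l2^-1) => a.
have -> : (a + 128 + 128 * v + 128) * Z = a * Z + 256 * Z + 128 * (v * Z).
  by ring.
by move: (a * Z) (v * Z) => w w'; lra.
Qed.

End sample_complexity.

Lemma hypotheses_pac_learnable (R : realType) (n d : nat) :
  pac_learnable (trace_dist R n) (hypotheses R n d)
    (sample_size (d * n * 12)).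
Proof.
move=> eps delta eps01 delta01 P h h_min m m_ge.
have /andP[e0 e1] := eps01.
pose p := (d * n * 12)%N; pose G := grid_size p eps.
pose err : R := Num.sqrt (2 * (@grid_step R G *+ (12 * n.-1 * d))).
have err_le : err <= eps / 8 by exact: grid_error_le.
(* Deviation [eps / 4] and covering error [eps / 8], both doubled by [erm_finite_cover], use
   [3 eps / 4]. *)
have err_sum : 2 * (eps / 4) + 2 * err <= eps.
  by move: err_le; move: err => x {h_min}; lra.
have m0 : (0 < m)%N by exact: leq_trans m_ge.
have t01 : 0 < eps / 4 <= 1 by apply/andP; split; lra.
have := @erm_finite_cover R _ _ (pure_state R n) (pure_state R n)
  (trace_dist R n) P (hypotheses R n d) (grid n d G)
  (fun k => overlap_loss (circuit n d (grid_params k))) err (eps / 4) m h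
  (fun k => measurable_overlap_loss _)
  (fun k => overlap_loss_bounds _)
  (fun f Ff => (hypotheses_loss Ff).1)
  (fun f Ff => (hypotheses_loss Ff).2)
  (fun f Ff => hypotheses_grid_cover G Ff)
  t01 m0 h_min.
move=> [B [mB BS PB]]; exists B; split => //.
  move=> S /BS hS hhat /hS /le_trans; exact.
apply: le_trans PB; rewrite lee_fin lerD2l lerN2 card_grid.
exact: failure_prob_le.
Qed.

Theorem theorem2 (R : realType) (c M : R) (hc : 0 <= c) (hM : 0 < M) :
  exists nu : nat -> R -> R -> nat,
    (exists K : R, forall (n : nat) (eps delta : R),
       (2 <= n)%N -> 0 < eps < 1 -> 0 < delta < 1 ->
       (nu n eps delta)%:R <=
         K * (1 / eps ^+ 2 *
              (n%:R `^ (c + 1) * ln (n%:R / eps) + ln (1 / delta)))) /\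
    (forall n : nat, (2 <= n)%N ->
       pac_learnable (trace_dist R n)
         (hypotheses R n `|Num.ceil (M * n%:R `^ c)|%N) (nu n)).
Proof.
exists (fun n => sample_size (`|Num.ceil (M * n%:R `^ c)|%N * n * 12)).
split; first exact: sample_size_le.
by move=> n _; exact: hypotheses_pac_learnable.
Qed.
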